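(* Let $h\ge 0$, $\ell\ge1$, let $b_1,\ldots,b_h,a_1,\ldots,a_\ell$ be positive integers, let $\beta=[0;b_1,\ldots,b_h,\overline{a_1,\ldots,a_\ell}]$, and for $k=1,\ldots,\ell$ let $C_k=\lim_{m\to\infty}P_{q_{h+m\ell+k}}(\beta)>0$, where $q_n=q_n(\beta)$. Then for $k=1,2,\ldots,\ell$ we have $$C_k=\left(\frac{1+a^2}{c!}\right)^{\frac{1}{c-2}}\prod_{t=1}^{\infty}\left(1-\frac{1}{u_k(t)^2}\right)\left|1-\frac{(1+2a^2)^2}{u_k(t)^2}\right|^{\frac{1}{c-2}}\prod_{s=1}^{c-1}\left|1-\frac{(1+2s)^2}{u_k(t)^2}\right|^{-\frac{1}{c-2}}$$ when $\ell$ is even, and $$C_k=\frac{1}{\prod_{s=1}^{c}|s-a|^{\frac1c}}\prod_{t=1}^{\infty}\left(1-\frac{1}{u_k(t)^2}\right)\prod_{s=0}^{c-1}\left|1-\frac{(1+2s-2a)^2}{u_k(t)^2}\right|^{-\frac1c}$$ when $\ell$ is odd. (In each formula the product over $s$ is inside the product over $t$.)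
   Context: The Sudler product is $P_N(\beta)=\prod_{r=1}^N|2\sin\pi r\beta|$. For an irrational $\gamma=[0;d_1,d_2,\ldots]$ with positive integer digits $d_i$, define $p_n(\gamma),q_n(\gamma)$ by $p_0=1,\ p_1=0,\ p_{n+1}=d_np_n+p_{n-1}$ and $q_0=0,\ q_1=1,\ q_{n+1}=d_nq_n+q_{n-1}$. An overline denotes the repeated block of a periodic continued fraction, and $\{x\}$ is the fractional part of $x$. It is known (Grepstad–Neumüller) that the limits $C_k$ exist and are positive. The constants $a,c$ and the sequence $u_k(t)$ refer to the purely periodic irrational $\alpha=[0;\overline{a_1,\ldots,a_\ell}]$: $c=q_{\ell+1}(\alpha)+p_\ell(\alpha)$, $\ a=\frac{c+\sqrt{c^2+4(-1)^{\ell-1}}}{2}$, $\ b=\frac{c-\sqrt{c^2+4(-1)^{\ell-1}}}{2}$; for $k=0,1,\ldots,\ell-1$, $$c_k=\frac{q_{\ell+k}(\alpha)-b\,q_k(\alpha)}{a-b},\qquad e_k=(-1)^{k-1}\frac{|a\,q_k(\alpha)-q_{\ell+k}(\alpha)|}{q_\ell(\alpha)},$$ extended to all $k\ge0$ periodically modulo $\ell$ (so $c_\ell=c_0$, $e_\ell=e_0$). For $k=1,\ldots,\ell$ put $\alpha_{\sigma_k}=[0;\overline{a_{k-1},\ldots,a_1,a_\ell,\ldots,a_k}]$ (with $\alpha_{\sigma_1}=[0;\overline{a_\ell,\ldots,a_1}]$) and $$u_k(t)=2\left(\frac{t}{|e_kc_k|}-\{t\alpha_{\sigma_k}\}+\frac12\right),\qquad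 t=1,2,\ldots$$ *)

(* Defs.v *)
From HB Require Import structures.
From mathcomp Require Import all_boot all_order all_algebra.
From mathcomp Require Import all_classical all_reals all_analysis.
Set Implicit Arguments.
Unset Strict Implicit.
Unset Printing Implicit Defensive.
Import Order.TTheory GRing.Theory Num.Theory.
Import numFieldNormedType.Exports.
Local Open Scope classical_set_scope.
Local Open Scope ring_scope.

(* A digit sequence is a function d : nat -> nat read at the indices 1, 2, ...;
   d 0 is never used.  Finite blocks b_1, ..., b_h and a_1, ..., a_l are
   likewise functions nat -> nat read only at 1..h and 1..l. *)

Fixpoint cf_rec (d : nat -> nat) (x0 x1 n : nat) : nat :=
  match n with
  | 0 => x0
  | m.+1 => match m with
            | 0 => x1
            | m'.+1 => d m * cf_rec d x0 x1 m + cf_rec d x0 x1 m'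
            end
  end.

(* p_n / q_n = [0; d_1, ..., d_{n-1}] *)
Definition cfp (d : nat -> nat) : nat -> nat := cf_rec d 1 0.
Definition cfq (d : nat -> nat) : nat -> nat := cf_rec d 0 1.

(* The value of [0; d_1, d_2, ...]; the term n = 0 of the sequence is a
   division by zero, which does not affect the limit. *)
Definition cf_value (R : realType) (d : nat -> nat) : R :=
  limn (fun n : nat => (cfp d n)%:R / (cfq d n)%:R : R).

(* Digits of [0; b_1, ..., b_h, overline(a_1, ..., a_l)], for l >= 1. *)
Definition cf_digits (h l : nat) (b a : nat -> nat) (i : nat) : nat :=
  if (i <= h)%N then b i else a (((i - h).-1 %% l).+1).

Definition pure_digits (l : nat) (a : nat -> nat) : nat -> nat :=
  cf_digits 0 l (fun=> 0%N) a.

(* The block a_{k-1}, ..., a_1, a_l, ..., a_k, indexed by 1..l, for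
   1 <= k <= l. *)
Definition rev_block (l k : nat) (a : nat -> nat) (i : nat) : nat :=
  if (i < k)%N then a (k - i)%N else a (l + k - i)%N.

Definition fract (R : realType) (x : R) : R := x - (Num.floor x)%:~R.

Definition sudler (R : realType) (N : nat) (x : R) : R :=
  \prod_(1 <= r < N.+1) `|2 * sin (pi * r%:R * x)|.

(* The infinite product of f 1, f 2, ... converges to L. *)
Definition infprod_to (R : realType) (f : nat -> R) (L : R) : Prop :=
  (fun T : nat => \prod_(1 <= t < T.+1) f t) @ \oo --> L.

Section Constants.
Variables (R : realType) (l : nat) (a : nat -> nat).

Let p := cfp (pure_digits l a).
Let q := cfq (pure_digits l a).

Definition const_c : nat := (q l.+1 + p l)%N.

Definition const_disc : R := const_c%:R ^+ 2 + 4 * (-1) ^+ l.-1.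

Definition const_a : R := (const_c%:R + Num.sqrt const_disc) / 2.

Definition const_b : R := (const_c%:R - Num.sqrt const_disc) / 2.

(* c_k and e_k, with k reduced modulo l *)
Definition coef_c (k : nat) : R :=
  let r := (k %% l)%N in
  ((q (l + r)%N)%:R - const_b * (q r)%:R) / (const_a - const_b).

Definition coef_e (k : nat) : R :=
  let r := (k %% l)%N in
  (-1) ^ (r%:Z - 1) * `|const_a * (q r)%:R - (q (l + r)%N)%:R| / (q l)%:R.

Definition alpha_sigma (k : nat) : R :=
  cf_value R (pure_digits l (rev_block l k a)).

Definition seq_u (k t : nat) : R :=
  2 * (t%:R / `|coef_e k * coef_c k| - fract (t%:R * alpha_sigma k) + 1 / 2).

End Constants.

(* Main.v *)
Require Import Defs.
From HB Require Import structures.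
From mathcomp Require Import all_boot all_order all_algebra.
From mathcomp Require Import all_classical all_reals all_analysis.
From mathcomp Require Import zify ring lra.
Set Implicit Arguments.
Unset Strict Implicit.
Unset Printing Implicit Defensive.
Import Order.TTheory GRing.Theory Num.Theory.
Import numFieldNormedType.Exports.
Local Open Scope classical_set_scope.
Local Open Scope ring_scope.

(* Put delta_n = q_n beta - p_n, P_N(y) = prod_(1 <= r <= N) |2 sin (pi (r beta + y))|,
   and write q, q', q'' for q_n, q_(n+l), q_(n+2l) with n = h + m l + k.  Pairing
   r with q - r and reindexing by r = t q_(n-1) mod q gives, by Tannery's theorem,
     P_q(z delta_n) / P_q(0) --> kappa(z)
       = |1 + z| prod_t |1 - (1 + 2 z)^2 / u_k(t)^2| / |1 - 1 / u_k(t)^2|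
   for every fixed z.  Taking the trace of the period matrix, q'' = c q' - (-1)^l q and
   delta_(n+l) = B delta_n with A B = (-1)^l.  Cutting [1, c q'] resp.
   [1, q''] into blocks of lengths q, q', q'' and letting m tend to infinity gives
     C^c prod_(0 <= s < c) kappa(s) = C^2 kappa(A^2)   for l even,
     C = C C^c prod_(0 <= s < c) kappa(s - A)          for l odd,
   which are solved for C. *)

(** * Continued fractions *)

(** Only ratios of shifted products are computed; the common part of P_q(z delta_n) and P_q(0)
    cancels. The unknown C occurs with different exponents on the two sides of each identity, so
    they determine it. The shifts arise by writing each error as a multiple of the error of the
    block that follows: delta_n = A^2 delta_(n+2l) when A B = 1, and delta_n = - A delta_(n+l) when
    A B = -1. The obstacle is division: at z = s, A^2 or s - A a factor of kappa might vanish. For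
    odd l the product of all C kappa(s - A) is 1, which excludes this. For even l the interval is
    also cut in the opposite order; this replaces A^2 by B^2 in (0, 1), where every factor is
    positive because u_k(t) >= 3. The preperiod only rescales the errors, and the limit of q_n
    |delta_n| is found once for every h and once more explicitly for h = 0, so u_k depends on the
    period alone. *)

Section ContinuedFractions.
Variables (R : realType).
Implicit Types (d : nat -> nat) (X Y : nat -> R).

Definition pos_digits d := forall i, (0 < i)%N -> (0 < d i)%N.

(** Denominators, numerators, their shifts and the errors [delta] all solve this recurrence. Its
    solution space is two-dimensional, so identities are checked at two indices. *)
Definition cf_solution d X :=
  forall n, X n.+2 = (d n.+1)%:R * X n.+1 + X n.

Lemma cfqSS d n : cfq d n.+2 = (d n.+1 * cfq d n.+1 + cfq d n)%N.
Proof. by []. Qed.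

Lemma cfpSS d n : cfp d n.+2 = (d n.+1 * cfp d n.+1 + cfp d n)%N.
Proof. by []. Qed.

Lemma cf_solution_cfq d : cf_solution d (fun n => (cfq d n)%:R).
Proof. by move=> n; rewrite cfqSS natrD natrM. Qed.

Lemma cf_solution_cfp d : cf_solution d (fun n => (cfp d n)%:R).
Proof. by move=> n; rewrite cfpSS natrD natrM. Qed.

Lemma nat_ind2 (P : nat -> Prop) :
  P 0%N -> P 1%N -> (forall n, P n -> P n.+1 -> P n.+2) -> forall n, P n.
Proof.
move=> P0 P1 PS n; suff: P n /\ P n.+1 by case.
by elim: n => [|n [Pn Pn1]]; split=> //; exact: PS.
Qed.

Lemma cf_solutionE d X : cf_solution d X ->
  forall n, X n = X 0%N * (cfp d n)%:R + X 1%N * (cfq d n)%:R.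
Proof.
move=> Xd; elim/nat_ind2 => [||n IH0 IH1]; rewrite ?mulr0 ?mulr1 ?addr0 ?add0r//.
by rewrite Xd {1}IH1 {1}IH0 cf_solution_cfp cf_solution_cfq; ring.
Qed.

Lemma cf_solution_lin d X Y (u v : R) : cf_solution d X -> cf_solution d Y ->
  cf_solution d (fun n => u * X n + v * Y n).
Proof. by move=> Xd Yd n; rewrite Xd Yd; ring. Qed.

(** One step of the recurrence has determinant -1. *)
Lemma cf_wronskian d X Y : cf_solution d X -> cf_solution d Y ->
  forall n, X n.+1 * Y n - X n * Y n.+1
            = (-1) ^+ n * (X 1%N * Y 0%N - X 0%N * Y 1%N).
Proof.
move=> Xd Yd; elim=> [|n IH]; first by rewrite expr0 mul1r.
by rewrite Xd Yd exprS -mulrA -IH; ring.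
Qed.

Lemma cfq_gt0 d n : pos_digits d -> (0 < cfq d n.+1)%N.
Proof.
move=> d0; elim/nat_ind2: n => [||n _ IH] //.
  by rewrite cfqSS addn_gt0 muln_gt0 d0.
by rewrite cfqSS addn_gt0 muln_gt0 d0 //= IH.
Qed.

Lemma cfq_le_succ d n : pos_digits d -> (cfq d n <= cfq d n.+1)%N.
Proof.
case: n => [|n] d0 //; rewrite cfqSS.
by rewrite (leq_trans _ (leq_addr _ _))// leq_pmull// d0.
Qed.

Lemma cfq_add_le d n : pos_digits d -> (cfq d n.+1 + cfq d n <= cfq d n.+2)%N.
Proof. by move=> d0; rewrite cfqSS leq_add2r leq_pmull// d0. Qed.

Lemma leq_cfq d n : pos_digits d -> (n <= cfq d n.+1)%N.
Proof.
move=> d0; elim/nat_ind2: n => [||n IH0 IH1] //; first exact: cfq_gt0.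
have := cfq_add_le n.+1 d0; have := cfq_gt0 n d0; lia.
Qed.

Definition delta d (n : nat) : R := (cfq d n)%:R * cf_value R d - (cfp d n)%:R.

Lemma cf_solution_delta d : cf_solution d (delta d).
Proof.
by move=> n; rewrite /delta cf_solution_cfp cf_solution_cfq; ring.
Qed.

(* Mobius form of the continued fraction [0; d_1, ..., d_{n-1}, d_n + y_n]. *)
Lemma cf_tailE d (y : nat -> R) n :
  (forall i, (i < n)%N -> y i * ((d i.+1)%:R + y i.+1) = 1) ->
  y 0%N * ((cfq d n.+1)%:R + y n * (cfq d n)%:R)
  = (cfp d n.+1)%:R + y n * (cfp d n)%:R.
Proof.
elim: n => [|n IH] yE; first by rewrite /cfp /cfq /=; ring.
have {}IH := IH (fun i ni => yE i (ltnW ni)).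
have yn := yE n (ltnSn n).
have tn : (d n.+1)%:R + y n.+1 != 0.
  by apply: contra_eq_neq yn => ->; rewrite mulr0 eq_sym oner_eq0.
apply: (mulIf (x := y n)).
  by apply: contra_eq_neq yn => ->; rewrite mul0r eq_sym oner_eq0.
rewrite !cf_solution_cfp !cf_solution_cfq.
transitivity (y 0%N * ((cfq d n.+1)%:R * (y n * ((d n.+1)%:R + y n.+1))
   + y n * (cfq d n)%:R)); first by ring.
rewrite yn mulr1 IH.
transitivity ((cfp d n.+1)%:R * (y n * ((d n.+1)%:R + y n.+1))
   + y n * (cfp d n)%:R); last by ring.
by rewrite yn mulr1.
Qed.

Lemma cf_det d n : (cfp d n.+1)%:R * (cfq d n)%:R - (cfp d n)%:R * (cfq d n.+1)%:R
  = - (-1) ^+ n :> R.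
Proof.
rewrite (cf_wronskian (@cf_solution_cfp d) (@cf_solution_cfq d)).
by rewrite /cfp /cfq /=; ring.
Qed.

(** Only n steps of the chain are assumed and [y n] just has to be nonnegative, since a reversed
    finite fraction has no infinite tail. *)
Lemma cf_tail_dist d (y : nat -> R) n : pos_digits d ->
  (forall i, (i < n)%N -> y i * ((d i.+1)%:R + y i.+1) = 1) ->
  0 <= y n -> (0 < n)%N ->
  `|y 0%N - (cfp d n)%:R / (cfq d n)%:R| <= ((cfq d n * cfq d n.+1)%:R)^-1.
Proof.
move=> d0 yE yn n0; have qn : 0 < (cfq d n)%:R :> R.
  by rewrite ltr0n -(prednK n0) cfq_gt0.
have qn1 : 0 < (cfq d n.+1)%:R :> R by rewrite ltr0n cfq_gt0.
have den : 0 < (cfq d n.+1)%:R + y n * (cfq d n)%:R.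
  by rewrite ltr_wpDr// mulr_ge0// ltW.
have -> : y 0%N = ((cfp d n.+1)%:R + y n * (cfp d n)%:R) /
   ((cfq d n.+1)%:R + y n * (cfq d n)%:R).
  by rewrite -(cf_tailE yE) mulfK// gt_eqF.
have -> : ((cfp d n.+1)%:R + y n * (cfp d n)%:R) /
   ((cfq d n.+1)%:R + y n * (cfq d n)%:R) - (cfp d n)%:R / (cfq d n)%:R
   = - (-1) ^+ n / ((cfq d n)%:R * ((cfq d n.+1)%:R + y n * (cfq d n)%:R)).
  rewrite -(cf_det d); field; rewrite !gt_eqF//.
rewrite normrM normrN normrX normrN1 expr1n mul1r normfV lef_pV2 ?posrE//.
- by rewrite natrM gtr0_norm ?mulr_gt0// ler_pM2l// lerDl mulr_ge0// ltW.
- by rewrite normr_gt0 mulf_neq0// gt_eqF.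
- by rewrite natrM; exact: mulr_gt0.
Qed.

Lemma cf_solution_shift d X n : cf_solution d X ->
  cf_solution (fun i => d (n + i)%N) (fun j => X (n + j)%N).
Proof. by move=> Xd j; rewrite !addnS Xd. Qed.

Lemma cfq_shift_ge d n j : (cfq d n.+1 * cfq (fun i => d (n + i)) j <= cfq d (n + j))%N.
Proof.
rewrite -(ler_nat R) natrM (cf_solutionE (cf_solution_shift n (@cf_solution_cfq d))).
by rewrite addn0 addn1 lerDr mulr_ge0.
Qed.

(** For fixed n the left side solves the recurrence shifted by n and vanishes at j = 0; its value at
    j = 1 is a determinant. *)
Lemma cf_convergentB d n j :
  (cfp d (n + j))%:R * (cfq d n)%:R - (cfq d (n + j))%:R * (cfp d n)%:R
  = - (-1) ^+ n * (cfq (fun i => d (n + i)%N) j)%:R :> R.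
Proof.
have S := cf_solution_shift n (cf_solution_lin (cfq d n)%:R (- (cfp d n)%:R)
  (@cf_solution_cfp d) (@cf_solution_cfq d)).
transitivity ((cfq d n)%:R * (cfp d (n + j))%:R + - (cfp d n)%:R * (cfq d (n + j))%:R : R).
  by ring.
by rewrite (cf_solutionE S) addn0 addn1 -(cf_det d n); ring.
Qed.

(** The numerator of the difference is, up to sign, a denominator of the shifted fraction, which is
    at most q_N / q_(n+1) by [cfq_shift_ge]. *)
Lemma cf_convergent_dist d n N : pos_digits d -> (0 < n <= N)%N ->
  `|(cfp d N)%:R / (cfq d N)%:R - (cfp d n)%:R / (cfq d n)%:R|
  <= ((cfq d n * cfq d n.+1)%:R)^-1 :> R.
Proof.
move=> d0 /andP[n0 nN]; have qn : 0 < (cfq d n)%:R :> R.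
  by rewrite ltr0n -(prednK n0) cfq_gt0.
have qn1 : 0 < (cfq d n.+1)%:R :> R by rewrite ltr0n cfq_gt0.
have qN : 0 < (cfq d N)%:R :> R by rewrite ltr0n -(prednK (leq_trans n0 nN)) cfq_gt0.
have := cf_convergentB d n (N - n); have := cfq_shift_ge d n (N - n).
rewrite subnKC// -(ler_nat R) natrM; set z : R := (cfq _ (N - n))%:R => zle zE.
have -> : (cfp d N)%:R / (cfq d N)%:R - (cfp d n)%:R / (cfq d n)%:R
   = - (-1) ^+ n * z / ((cfq d N)%:R * (cfq d n)%:R).
  by rewrite -zE; field; rewrite !gt_eqF.
rewrite normrM normfV normrM normrN normrX normrN1 expr1n mul1r (@ger0_norm _ z) ?/z//.
rewrite ger0_norm ?mulr_ge0// natrM ler_pdivrMr ?mulr_gt0//.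
rewrite -/z ler_pdivlMl ?mulr_gt0// -mulrA mulrC ler_pM2r//.
Qed.

Lemma cvgn_tail_bound (x : nat -> R) (M : R) :
  (forall n N, (0 < n <= N)%N -> `|x N - x n| <= M / n%:R) -> cvgn x.
Proof.
move=> xM; apply/cauchy_cvgP; apply/cauchy_exP => e e0.
have [n Mn] : exists n, M / n.+1%:R < e.
  (* The divisor is 1 + |M| because M may be zero or negative. *)
  have := @near_infty_natSinv_lt R (PosNum (divr_gt0 e0 (ltr_pwDl ltr01 (normr_ge0 M)))).
  case=> n _ /(_ n (leqnn n)) /= Hn; exists n.
  rewrite (le_lt_trans (y := (1 + `|M|) / n.+1%:R))//.
    by rewrite ler_pM2r ?invr_gt0// (le_trans (ler_norm _))// lerDr.
  by rewrite mulrC -ltr_pdivlMr// ltr_pwDl.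
exists (x n.+1); exists n.+1 => // N /= nN.
by rewrite /ball /= distrC (le_lt_trans _ Mn)// xM.
Qed.

Lemma cvg_subseq (x : nat -> R) (y : R) (f : nat -> nat) :
  (forall n, n <= f n)%N -> x @ \oo --> y -> (fun n => x (f n)) @ \oo --> y.
Proof.
move=> fn xy; apply: cvg_comp xy; apply/cvgnyPge => N.
by exists N => // n /= Nn; rewrite (leq_trans Nn).
Qed.

Lemma inv_cfq_mul_le d n : pos_digits d -> (0 < n)%N ->
  ((cfq d n * cfq d n.+1)%:R)^-1 <= n%:R^-1 :> R.
Proof.
move=> d0 n0; rewrite lef_pV2 ?posrE ?ltr0n// ?muln_gt0; last first.
  by rewrite -{1}(prednK n0) !cfq_gt0.
rewrite ler_nat (leq_trans (leq_cfq n d0))// leq_pmull//.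
by rewrite -(prednK n0) cfq_gt0.
Qed.

Lemma cf_value_cvg d : pos_digits d ->
  (fun n => (cfp d n)%:R / (cfq d n)%:R : R) @ \oo --> cf_value R d.
Proof.
move=> d0; suff : cvgn (fun n => (cfp d n)%:R / (cfq d n)%:R : R) by [].
apply: (@cvgn_tail_bound _ 1) => n N nN; rewrite (le_trans (cf_convergent_dist d0 nN))//.
by rewrite mul1r inv_cfq_mul_le//; case/andP: nN.
Qed.

Lemma cf_value_dist d n : pos_digits d -> (0 < n)%N ->
  `|cf_value R d - (cfp d n)%:R / (cfq d n)%:R| <= ((cfq d n * cfq d n.+1)%:R)^-1.
Proof.
move=> d0 n0; rewrite ler_distl.
have H N : (n <= N)%N -> `|(cfp d N)%:R / (cfq d N)%:R - (cfp d n)%:R / (cfq d n)%:R|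
    <= ((cfq d n * cfq d n.+1)%:R)^-1 :> R.
  by move=> nN; rewrite cf_convergent_dist// n0.
have V := cf_value_cvg d0.
apply/andP; split; [apply: (cvgr_to_ge V) | apply: (cvgr_to_le V)];
  by exists n => // N /= /H; rewrite ler_distl => /andP[].
Qed.

Lemma delta_le d n : pos_digits d -> (0 < n)%N ->
  `|delta d n| * (cfq d n.+1)%:R <= 1.
Proof.
move=> d0 n0; have qn : 0 < (cfq d n)%:R :> R.
  by rewrite ltr0n -(prednK n0) cfq_gt0.
have qn1 : 0 < (cfq d n.+1)%:R :> R by rewrite ltr0n cfq_gt0.
have -> : delta d n = (cfq d n)%:R * (cf_value R d - (cfp d n)%:R / (cfq d n)%:R).
  by rewrite /delta; field; rewrite gt_eqF.
rewrite normrM ger0_norm// -ler_pdivlMr// -ler_pdivlMl// mulrC mul1r -invfM -natrM.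
by rewrite [X in `|_ - X|]mulrC cf_value_dist.
Qed.

Lemma cvg_delta d : pos_digits d -> delta d @ \oo --> (0 : R).
Proof.
move=> d0; apply/cvgr0Pnorm_le => e e0.
have [n _ Hn] := @near_infty_natSinv_lt R (PosNum e0).
exists n.+1 => // m /= nm; have m0 : (0 < m)%N by exact: leq_trans nm.
have Q : 0 < (cfq d m.+1)%:R :> R by rewrite ltr0n cfq_gt0.
rewrite (le_trans (y := (cfq d m.+1)%:R^-1))//.
  by rewrite -[leRHS]mul1r ler_pdivlMr// delta_le.
rewrite (le_trans (y := m%:R^-1))//.
  by rewrite lef_pV2 ?posrE//; [rewrite ler_nat leq_cfq|rewrite ltr0n].
have nm1 : (n <= m.-1)%N by rewrite -ltnS prednK.
by have := Hn _ nm1; rewrite /= prednK// => /ltW.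
Qed.

(* Pass to the limit in the sign of p_N q_n - q_N p_n for N >= n. *)
Lemma delta_sign_le d n : pos_digits d -> (-1) ^+ n * delta d n <= 0.
Proof.
move=> d0; rewrite -oppr_ge0.
have V : (fun N => - ((-1) ^+ n * ((cfq d n)%:R * ((cfp d N)%:R / (cfq d N)%:R) - (cfp d n)%:R : R)))
    @ \oo --> - ((-1) ^+ n * delta d n).
  apply: cvgN; apply: cvgM; first exact: cvg_cst.
  apply: cvgB; last exact: cvg_cst.
  by apply: cvgM; [exact: cvg_cst|exact: cf_value_cvg].
apply: (cvgr_to_ge V); exists n.+1 => // N /= nN.
have := cf_convergentB d n (N - n); rewrite subnKC; last exact: ltnW.
set z : R := (cfq _ (N - n))%:R => zE.
have qN : 0 < (cfq d N)%:R :> R by rewrite ltr0n -(ltn_predK nN) cfq_gt0.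
have -> : (cfq d n)%:R * ((cfp d N)%:R / (cfq d N)%:R) - (cfp d n)%:R
    = - (-1) ^+ n * z / (cfq d N)%:R :> R.
  by rewrite -zE; field; rewrite gt_eqF.
by rewrite !mulNr mulrN opprK mulrA mulrA -expr2 sqrr_sign mul1r divr_ge0.
Qed.

Lemma delta_det d n :
  delta d n.+1 * (cfq d n)%:R - delta d n * (cfq d n.+1)%:R = (-1) ^+ n.
Proof.
rewrite (cf_wronskian (@cf_solution_delta d) (@cf_solution_cfq d)).
by rewrite /delta /cfp /cfq /=; ring.
Qed.

Lemma delta_norm d n : pos_digits d -> `|delta d n| = - ((-1) ^+ n * delta d n).
Proof.
move=> d0; rewrite -(ler0_norm (delta_sign_le n d0)).
by rewrite normrM normrX normrN1 expr1n mul1r.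
Qed.

(** The errors alternate in sign, so the two terms of the determinant add up. Divided by q_(n+1)
    |delta_(n+1)|, this writes 1 / (q |delta|) as a ratio of consecutive denominators plus a ratio
    of consecutive errors. *)
Lemma delta_wronskian d n : pos_digits d ->
  (cfq d n.+1)%:R * `|delta d n| + (cfq d n)%:R * `|delta d n.+1| = 1.
Proof.
move=> d0; rewrite !delta_norm// exprS.
transitivity ((-1) ^+ n * (delta d n.+1 * (cfq d n)%:R - delta d n * (cfq d n.+1)%:R)).
  by ring.
by rewrite delta_det -expr2 sqrr_sign.
Qed.

Lemma delta_recE d n : pos_digits d ->
  `|delta d n| = (d n.+1)%:R * `|delta d n.+1| + `|delta d n.+2|.
Proof. by move=> d0; rewrite !delta_norm// cf_solution_delta !exprS; ring. Qed.

(** If one error vanished, the recurrence between nonnegative terms would make the next one vanish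
    too, against [delta_wronskian]. *)
Lemma delta_gt0 d n : pos_digits d -> 0 < `|delta d n|.
Proof.
move=> d0; rewrite normr_gt0; apply/negP => /eqP dn.
have := delta_recE n d0; rewrite dn normr0 => /esym/eqP.
rewrite paddr_eq0 ?mulr_ge0// mulf_eq0 pnatr_eq0 (gtn_eqF (d0 _ _))//= => /andP[dn1 _].
by have := delta_wronskian n d0; rewrite dn (eqP dn1) normr0 !mulr0 addr0 => /eqP;
  rewrite eq_sym oner_eq0.
Qed.

(** An integer value of t x would make every t delta_n a nonzero integer, although these numbers
    tend to 0. *)
Lemma cf_value_irrational d (t z : int) : pos_digits d -> t != 0 ->
  t%:~R * cf_value R d != z%:~R.
Proof.
move=> d0 t0; apply/negP => /eqP tx.
have E n : t%:~R * delta d n = ((cfq d n)%:Z * z - (cfp d n)%:Z * t)%:~R.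
  rewrite rmorphB !rmorphM /= -tx /delta; ring.
have t1 n : 1 <= `|t%:~R * delta d n|.
  have : t%:~R * delta d n != 0.
    by rewrite mulf_neq0 ?intr_eq0// -normr_gt0 delta_gt0.
  by rewrite E intr_eq0 -intr_norm ler1z -gtz0_ge1 normr_gt0.
have := cvg_norm (cvgM (cvg_cst (t%:~R : R)) (cvg_delta d0)).
rewrite mulr0 normr0 => V; suff : (1 : R) <= 0 by rewrite ler10.
by apply: (cvgr_to_ge (V _ _ _)); exists 0%N => // n _ /=; exact: t1.
Qed.

Lemma cf_value_tail_dist d (y : nat -> R) n : pos_digits d ->
  (forall i, (i < n)%N -> y i * ((d i.+1)%:R + y i.+1) = 1) ->
  0 <= y n -> (0 < n)%N -> `|y 0%N - cf_value R d| <= 2 / n%:R.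
Proof.
move=> d0 yE yn n0; apply: (le_trans (ler_distD ((cfp d n)%:R / (cfq d n)%:R) _ _)).
have -> : 2 / n%:R = n%:R^-1 + n%:R^-1 :> R by ring.
rewrite lerD//.
  by rewrite (le_trans (cf_tail_dist d0 yE yn n0))// inv_cfq_mul_le.
by rewrite distrC (le_trans (cf_value_dist d0 n0))// inv_cfq_mul_le.
Qed.

(** The quotients q_(n-i-1) / q_(n-i) satisfy the chain relation with the digits read downwards from
    d_(n-1); j matching digits give an error of order 1/j. *)
Lemma cf_reversal_dist d d' n j : pos_digits d -> pos_digits d' ->
  (0 < j)%N -> (j < n)%N -> (forall i, (0 < i <= j)%N -> d' i = d (n - i)%N) ->
  `|(cfq d n.-1)%:R / (cfq d n)%:R - cf_value R d'| <= 2 / j%:R.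
Proof.
move=> d0 d'0 j0 jn dE.
pose y i : R := (cfq d (n - i).-1)%:R / (cfq d (n - i))%:R.
have -> : (cfq d n.-1)%:R / (cfq d n)%:R = y 0%N by rewrite /y subn0.
apply: (@cf_value_tail_dist _ y) => //; last by rewrite divr_ge0.
move=> i ij; rewrite dE ?ij// /y.
have -> : (n - i)%N = (n - i.+1).+1 by lia.
have -> : (n - i.+1)%N = (n - i.+1).-1.+1 by lia.
rewrite /= cf_solution_cfq; set m := (n - i.+1).-1.
have qn1 : 0 < (cfq d m.+1)%:R :> R by rewrite ltr0n cfq_gt0.
have qn2 : 0 < (cfq d m.+2)%:R :> R by rewrite ltr0n cfq_gt0.
by move: qn2; rewrite cf_solution_cfq => qn2; field; rewrite !gt_eqF.
Qed.

End ContinuedFractions.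

(** * Eventually periodic digits *)

Section PeriodicDigits.
Variables (R : realType) (h l : nat) (b a : nat -> nat).
Hypothesis l_gt0 : (0 < l)%N.
Hypothesis b_gt0 : forall i : nat, (1 <= i <= h)%N -> (0 < b i)%N.
Hypothesis a_gt0 : forall i : nat, (1 <= i <= l)%N -> (0 < a i)%N.

Local Notation dig := (cf_digits h l b a).
Local Notation dp := (pure_digits l a).
Local Notation c := (const_c l a).
Local Notation A := (const_a R l a).
Local Notation B := (const_b R l a).
Local Notation p n := (cfp dp n).
Local Notation q n := (cfq dp n).

Lemma cf_digits_pos : pos_digits dig.
Proof.
move=> i i0; rewrite /cf_digits; case: (leqP i h) => ih; first by rewrite b_gt0// i0.
by rewrite a_gt0//= ltn_pmod.
Qed.

Lemma pure_digits_pos : pos_digits dp.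
Proof.
move=> i i0; rewrite /pure_digits /cf_digits leqn0 gtn_eqF//=.
by rewrite a_gt0//= ltn_pmod.
Qed.

Lemma rev_block_pos k : (1 <= k <= l)%N -> pos_digits (pure_digits l (rev_block l k a)).
Proof.
move=> /andP[k1 kl] i i0; rewrite /pure_digits /cf_digits leqn0 gtn_eqF//= /rev_block.
have := ltn_pmod (i - 0).-1 l_gt0.
set r := ((i - 0).-1 %% l)%N => rl.
by case: (ltnP r.+1 k) => rk; rewrite a_gt0//; lia.
Qed.

Lemma cf_digits_tail i : (0 < i)%N -> dig (h + i) = dp i.
Proof.
move=> i0; rewrite /pure_digits /cf_digits leqn0 gtn_eqF//= -{2}[h]addn0 leq_add2l leqn0 gtn_eqF//=.
by rewrite subn0 addnC addnK.
Qed.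

Lemma pure_digits_period i : (0 < i)%N -> dp (i + l) = dp i.
Proof.
move=> i0; rewrite /pure_digits /cf_digits !leqn0 !gtn_eqF ?addn_gt0 ?i0//= !subn0.
by rewrite -(prednK i0) addSn /= modnDr.
Qed.

Lemma cf_solution_tail (X : nat -> R) : cf_solution dig X ->
  cf_solution dp (fun j => X (h + j)%N).
Proof. by move=> Xd j; rewrite !addnS Xd -addnS cf_digits_tail. Qed.

Lemma cf_solution_period (X : nat -> R) : cf_solution dp X ->
  cf_solution dp (fun j => X (j + l)%N).
Proof. by move=> Xd j; rewrite !addSn Xd -addSn pure_digits_period. Qed.

(* Cayley-Hamilton for the period matrix, whose trace is c. *)
Lemma cfq_period_gt0 : (0 < q l)%N.
Proof.
case: l l_gt0 a_gt0 => // n _ a0; apply: cfq_gt0 => i i0.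
by rewrite /pure_digits /cf_digits leqn0 gtn_eqF//= a0//= ltn_pmod.
Qed.

Lemma cf_solution_trace (X : nat -> R) n : cf_solution dp X ->
  X (n + l + l)%N = c%:R * X (n + l)%N - (-1) ^+ l * X n.
Proof.
move=> Xd; apply/eqP; rewrite -subr_eq0; apply/eqP.
have S1 := cf_solution_period Xd; have S2 := cf_solution_period S1.
(* The combination is again a solution, so its values at 0 and 1 determine it; there the claim is a
   polynomial identity in p_l, p_(l+1), q_l, q_(l+1). *)
have := cf_solutionE (cf_solution_lin 1 1 S2 (cf_solution_lin (- c%:R) ((-1) ^+ l) S1 Xd)) n.
rewrite !add0n !add1n.
have E j : X (j + l)%N = X l * (p j)%:R + X l.+1 * (q j)%:R.
  by rewrite (cf_solutionE S1).
rewrite !E !(cf_solutionE Xd l) !(cf_solutionE Xd l.+1).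
have := cf_det R dp l.
set z := (-1) ^+ l => zE; have -> : z = - ((p l.+1)%:R * (q l)%:R - (p l)%:R * (q l.+1)%:R).
  by rewrite zE opprK.
have -> : c%:R = (q l.+1)%:R + (p l)%:R :> R by rewrite /const_c natrD.
by move=> H; apply: etrans (etrans H _); ring.
Qed.

Lemma cfp_gt0 n : (0 < p n.+2)%N.
Proof.
elim/nat_ind2: n => [||n IH _]; first by rewrite cfpSS /cfp /= muln0.
  by rewrite cfpSS /cfp/= addn0 muln0 add0n muln1 pure_digits_pos.
by rewrite cfpSS addn_gt0 IH orbT.
Qed.

Lemma const_c_gt0 : (0 < c)%N.
Proof. by rewrite addn_gt0 cfq_gt0//; exact: pure_digits_pos. Qed.

(** An even l is at least 2, so two denominators and p_l contribute at least 1 each. This makes c^2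
    - 4 positive and the exponent 1/(c - 2) meaningful. *)
Lemma const_c_ge3 : ~~ odd l -> (3 <= c)%N.
Proof.
move=> lo; have [n ln] : exists n, l = n.+2.
  by move: lo l_gt0; case: (l) => [|[|n]]// _ _; exists n.
have := cfp_gt0 n; have := cfq_add_le n.+1 pure_digits_pos.
have := cfq_gt0 n.+1 pure_digits_pos; have := cfq_gt0 n pure_digits_pos.
rewrite /const_c -ln.
set x := cfq _ _; set y := cfq _ _; set z := cfq _ _; set w := cfp _ _.
by clear; lia.
Qed.

Lemma const_discE : const_disc R l a = c%:R ^+ 2 - 4 * (-1) ^+ l.
Proof.
rewrite /const_disc; have -> : (-1) ^+ l = - (-1) ^+ l.-1 :> R; last by ring.
by case: l l_gt0 => // n _; rewrite exprS mulN1r.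
Qed.

Lemma const_disc_gt0 : 0 < const_disc R l a.
Proof.
rewrite const_discE -signr_odd; have [lo|/negPf lo] := boolP (odd l).
  by rewrite expr1 mulrN1 opprK addr_gt0// exprn_gt0// ltr0n const_c_gt0.
have := const_c_ge3 (negbT lo); rewrite -(ler_nat R) => c3.
by rewrite expr0; nra.
Qed.

(** Together with [const_abM]: A and B are the eigenvalues of the period matrix, of trace c and
    determinant (-1)^l. *)
Lemma const_abD : A + B = c%:R.
Proof. by rewrite /const_a /const_b; field. Qed.

Lemma const_abM : A * B = (-1) ^+ l.
Proof.
have := sqr_sqrtr (ltW const_disc_gt0); rewrite {2}const_discE.
rewrite /const_a /const_b; set s := Num.sqrt _ => s2.
transitivity ((c%:R ^+ 2 - s ^+ 2) / 4); first by field.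
by rewrite s2; field.
Qed.

Lemma const_ab_lt : B < A.
Proof.
have := const_disc_gt0; rewrite -sqrtr_gt0 /const_a /const_b.
by set s := Num.sqrt _ => s0; lra.
Qed.

Lemma const_a_gt1 : 1 < A.
Proof.
have s0 := const_disc_gt0; have := s0; rewrite -sqrtr_gt0.
have := sqr_sqrtr (ltW s0); rewrite {2}const_discE /const_a.
set s := Num.sqrt _ => s2 {}s0.
have := const_c_gt0; rewrite -(ler_nat R) => c1.
move: s2; rewrite -signr_odd; have [lo|lo] := boolP (odd l).
  by rewrite expr1 mulrN1 opprK => s2; nra.
have := const_c_ge3 lo; rewrite -(ler_nat R) => c3 _; lra.
Qed.

Lemma const_b_lt1 : `|B| < 1.
Proof.
have A1 := const_a_gt1; have : `|A * B| = 1 by rewrite const_abM normrX normrN1 expr1n.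
rewrite normrM gtr0_norm ?(lt_trans ltr01)// => AB.
have := normr_ge0 B; nra.
Qed.

Lemma const_b_neq0 : B != 0.
Proof.
have : A * B != 0 by rewrite const_abM signr_eq0.
by rewrite mulf_eq0 negb_or => /andP[].
Qed.

(** The difference X_(j+l) - B X_j measures the growing component. It is multiplied by A > 1 at
    every period, so it can tend to 0 only if it is 0. *)
Lemma cf_solution_decay (X : nat -> R) j : cf_solution dp X -> X @ \oo --> (0 : R) ->
  X (j + l)%N = B * X j.
Proof.
move=> Xd X0; apply/eqP; rewrite -subr_eq0 -normr_le0.
pose E m := X (j + m * l + l)%N - B * X (j + m * l)%N.
have Em m : E m = A ^+ m * E 0%N.
  elim: m => [|m IH]; first by rewrite mul1r.
  rewrite exprS -mulrA -IH /E mulSn [(l + _)%N]addnC addnA cf_solution_trace//.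
  by rewrite -const_abD -const_abM; ring.
have E0 m : `|X (j + l)%N - B * X j| <= `|E m|.
  have -> : X (j + l)%N - B * X j = E 0%N by rewrite /E mul0n addn0.
  rewrite [E m]Em normrM normrX ler_peMl// exprn_ege1//.
  exact: le_trans (ltW const_a_gt1) (ler_norm _).
have S i : (fun m => X (j + m * l + i)%N) @ \oo --> (0 : R).
  by apply: (@cvg_subseq R X 0 (fun m => j + m * l + i)%N) X0 => m; move: l_gt0; nia.
have V : (fun m => `|E m|) @ \oo --> `|0 - B * 0|.
  apply: cvg_norm; apply: cvgB; first exact: S.
  apply: cvgM; [exact: cvg_cst|].
  by under eq_fun do rewrite -[(j + _)%N]addn0; exact: S.
move: V; rewrite mulr0 subr0 normr0 => V.
by apply: (cvgr_to_ge V); exact: nearW.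
Qed.

(** One period later the value at 0 becomes q_l X_1, which must equal B X_0 = 0. So decaying
    solutions form a line and need comparing only at index 0. *)
Lemma cf_solution_decay_unique (X : nat -> R) : cf_solution dp X ->
  (forall j, X (j + l)%N = B * X j) -> X 0%N = 0 -> forall j, X j = 0.
Proof.
move=> Xd XB X0; have X1 : X 1%N = 0.
  have := XB 0%N; rewrite X0 mulr0 add0n (cf_solutionE Xd) X0 mul0r add0r => /eqP.
  rewrite mulf_eq0 pnatr_eq0 => /orP[/eqP//|].
  by rewrite gtn_eqF// cfq_period_gt0.
by move=> j; rewrite (cf_solutionE Xd) X0 X1 !mul0r addr0.
Qed.

Lemma delta_period j : delta R dig (h + j + l) = B * delta R dig (h + j).
Proof.
have S := cf_solution_tail (@cf_solution_delta R dig).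
rewrite -addnA (cf_solution_decay j S)//; apply: (cvg_subseq (f := addn h)).
  by move=> n; rewrite leq_addl.
exact/cvg_delta/cf_digits_pos.
Qed.

Lemma pure_delta_period j : delta R dp (j + l) = B * delta R dp j.
Proof.
apply: cf_solution_decay; first exact: cf_solution_delta.
exact/cvg_delta/pure_digits_pos.
Qed.

(** Both sides decay and agree at j = 0, where the error of the pure fraction is -1; hence the
    sign. *)
Lemma delta_proportional j : delta R dig (h + j) = - delta R dig h * delta R dp j.
Proof.
have S := cf_solution_tail (@cf_solution_delta R dig).
have T := cf_solution_lin 1 (delta R dig h) S (@cf_solution_delta R dp).
have := @cf_solution_decay_unique _ T.
move=> /(_ _ _ j) H; apply/eqP; rewrite mulNr -addr_eq0 -{1}[delta R dig _]mul1r H//.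
  by move=> i; rewrite addnA delta_period pure_delta_period; ring.
by rewrite addn0 [delta R dp 0]/delta /cfq /cfp/=; ring.
Qed.

(** The left side has lost the growing component of q, and both sides are -q_l at j = 0. This turns
    |e_k| into an error of the purely periodic number. *)
Lemma cfq_decay j : A * (q j)%:R - (q (j + l))%:R = (q l)%:R * delta R dp j.
Proof.
have Q := @cf_solution_cfq R dp.
have T := cf_solution_lin 1 (- (q l)%:R) (cf_solution_lin A (-1) Q (cf_solution_period Q))
  (@cf_solution_delta R dp).
have := cf_solution_decay_unique T; move=> /(_ _ _ j) H.
apply/eqP; rewrite -subr_eq0; apply/eqP; rewrite -[RHS]H; first by ring.
  move=> i; rewrite pure_delta_period (cf_solution_trace i Q) -const_abD -const_abM; ring.
by rewrite add0n /delta /cfq /cfp/=; ring.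
Qed.

Lemma norm_coef_e k : `|coef_e R l a k| = `|delta R dp (k %% l)|.
Proof.
rewrite /coef_e [(l + _)%N]addnC cfq_decay normrM normfV !normrM !normr_id.
rewrite [X in X * _ / _](_ : _ = 1) ?mul1r; last first.
  (* At r = 0 the exponent is -1, so negative integer powers occur. *)
  by case: (_ - 1) => n; rewrite ?NegzE -?exprnP -?exprnN ?normfV normrX normrN1 expr1n ?invr1.
by rewrite mulrAC mulfV ?mul1r// normr_nat pnatr_eq0 gtn_eqF// cfq_period_gt0.
Qed.

Lemma pure_delta_periodM m r : delta R dp (m * l + r) = B ^+ m * delta R dp r.
Proof.
elim: m => [|m IH]; first by rewrite mul1r.
by rewrite mulSn -addnA addnC pure_delta_period IH exprS mulrA.
Qed.

(** c_r is the coefficient of A^m in q_(m l + r), and delta_(m l + r) = B^m delta_r. The product is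
    (A B)^m c_r delta_r plus a term of order B^(2m), and |A B| = 1. *)
Lemma cvg_pure_qdelta_lt r : (r < l)%N ->
  (fun m => (q (m * l + r))%:R * `|delta R dp (m * l + r)|) @ \oo
  --> `|coef_e R l a r * coef_c R l a r|.
Proof.
move=> rl; have AB : A - B != 0 by rewrite subr_eq0 gt_eqF// const_ab_lt.
pose C : R := coef_c R l a r; pose D := delta R dp r.
pose F : R := (q l)%:R * D / (A - B) * D.
have QE m : (q (m * l + r))%:R * delta R dp (m * l + r)
    = (A * B) ^+ m * (C * D) + (B ^+ m) ^+ 2 * F.
  have G : (q (m * l + r + l))%:R - B * (q (m * l + r))%:R = A ^+ m * (C * (A - B)).
    rewrite /C /coef_c modn_small// divfK//.
    elim: m => [|m IH]; first by rewrite mul1r add0n addnC.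
    rewrite exprS -mulrA -IH.
    have -> : (m.+1 * l + r = m * l + r + l)%N by rewrite mulSn; lia.
    rewrite (cf_solution_trace (m * l + r) (@cf_solution_cfq R dp)).
    by rewrite -const_abD -const_abM; ring.
  have W := cfq_decay (m * l + r); rewrite pure_delta_periodM in W.
  apply: (mulIf AB); rewrite pure_delta_periodM.
  transitivity ((((q (m * l + r + l))%:R - B * (q (m * l + r))%:R) +
     (A * (q (m * l + r))%:R - (q (m * l + r + l))%:R)) * (B ^+ m * D)).
    by rewrite /D; ring.
  rewrite W G /F -/D [(A * B) ^+ m]exprMn; move: (A ^+ m) (B ^+ m) => x y.
  by field.
have V : (fun m => (B ^+ m) ^+ 2 * F) @ \oo --> 0 * 0 * F.
  apply: cvgM; last exact: cvg_cst.
  by under eq_fun do rewrite expr2; apply: cvgM; apply: cvg_expr; exact: const_b_lt1.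
rewrite -/C normrM norm_coef_e modn_small// -/D mulrC -normrM.
have -> : `|C * D| = `|C * D| + 0 by rewrite addr0.
have sg m : `|((-1) ^+ l) ^+ m| = 1 :> R by rewrite -exprM normrX normrN1 expr1n.
have U : (fun m => (q (m * l + r))%:R * `|delta R dp (m * l + r)|) =
  (fun m => `|C * D + ((-1) ^+ l) ^+ m * ((B ^+ m) ^+ 2 * F)|).
  apply/funext => m; rewrite -[X in X * _]ger0_norm// -normrM QE const_abM.
  have ss : ((-1) ^+ l) ^+ m * ((-1) ^+ l) ^+ m = 1 :> R.
    by rewrite -expr2 -[_ ^+ m]exprM sqrr_sign.
  move: ss (sg m); move: (((-1) ^+ l) ^+ m) => s ss sN.
  move: (C * D) (_ * F) => x y.
  by rewrite -[RHS]mul1r -sN -normrM mulrDr [s * (s * _)]mulrA ss mul1r.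
rewrite U addr0; apply: cvg_norm; rewrite -[X in _ --> X]addr0.
apply: cvgD; first exact: cvg_cst.
apply/cvgr0Pnorm_lt => e e0; move: V; rewrite mulr0 mul0r.
move=> /cvgr0Pnorm_lt/(_ e e0); apply: filterS => m.
by move=> H; rewrite normrM sg mul1r.
Qed.

(** For k = l the constants are those of k = 0, and the sequence is that of k = 0 advanced by one
    period. *)
Lemma cvg_pure_qdelta k : (k <= l)%N ->
  (fun m => (q (m * l + k))%:R * `|delta R dp (m * l + k)|) @ \oo
  --> `|coef_e R l a k * coef_c R l a k|.
Proof.
rewrite leq_eqVlt => /predU1P[->|]; last exact: cvg_pure_qdelta_lt.
have -> : coef_e R l a l * coef_c R l a l = coef_e R l a 0 * coef_c R l a 0.
  by rewrite /coef_e /coef_c modnn mod0n.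
under eq_fun do rewrite addnC -mulSn -[(_ * l)%N]addn0.
exact: (cvg_subseq (f := S)) (cvg_pure_qdelta_lt l_gt0).
Qed.

Lemma pure_digits_rev m k i : (1 <= k <= l)%N -> (0 < i <= m * l)%N ->
  pure_digits l (rev_block l k a) i = dp (m * l + k - i).
Proof.
move=> /andP[k1 kl] /andP[i0 im]; rewrite /pure_digits /cf_digits leqn0 gtn_eqF//= subn0.
rewrite leqn0 gtn_eqF ?subn0/=; last by lia.
have := ltn_pmod i.-1 l_gt0; have := divn_eq i.-1 l.
set r := (i.-1 %% l)%N; set j := (i.-1 %/ l)%N => iE rl.
have jm : (j < m)%N.
  have : (j * l < m * l)%N by lia.
  by rewrite ltn_mul2r => /andP[].
have -> : i = (j * l + r).+1 by rewrite -iE prednK.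
have mj : (m * l = (m - j).-1 * l + j * l + l)%N by rewrite -mulnDl -mulSnr; congr (_ * _)%N; lia.
(* Once j whole periods are removed, r + 1 < k steps back stay in the block of index m l + k;
   otherwise they reach the block before it. *)
rewrite /rev_block; case: (ltnP r.+1 k) => rk.
  have -> : ((m * l + k - (j * l + r).+1).-1 = (m - j).-1.+1 * l + (k - r.+2))%N.
    by rewrite mj mulSnr; lia.
  by rewrite modnMDl modn_small; [congr a; lia|lia].
have -> : ((m * l + k - (j * l + r).+1).-1 = (m - j).-1 * l + (l + k - r.+2))%N.
  by rewrite mj; lia.
by rewrite modnMDl modn_small; [congr a; lia|lia].
Qed.

(** The m l digits preceding index h + m l + k all lie in the periodic part, so the preperiod does
    not affect the limit. *)
Lemma cvg_reversal k : (1 <= k <= l)%N ->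
  (fun m => (cfq dig (h + m * l + k).-1)%:R / (cfq dig (h + m * l + k))%:R) @ \oo
  --> alpha_sigma R l a k.
Proof.
move=> kl; have /andP[k1 _] := kl.
apply/cvgrPdist_le => e e0; have e2 : 0 < e / 2 by rewrite divr_gt0.
have [N _ HN] := @near_infty_natSinv_lt R (PosNum e2).
exists N.+1 => // m /= Nm; rewrite distrC.
have m0 : (0 < m)%N by exact: leq_trans Nm.
have ml : (m <= m * l)%N by rewrite leq_pmulr.
apply: le_trans (_ : 2 / (m * l)%:R <= _).
  apply: cf_reversal_dist; [exact: cf_digits_pos|exact: rev_block_pos|lia|lia|].
  move=> i /andP[i0 iml]; rewrite (@pure_digits_rev m)//; last by rewrite i0.
  by rewrite -cf_digits_tail; [congr (dig _); lia|lia].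
have /HN : (N <= (m * l).-1)%N by lia.
rewrite /= prednK; last by lia.
by rewrite ltr_pdivlMr// mulrC => /ltW.
Qed.

Lemma delta_ratio m k : (0 < k)%N ->
  `|delta R dig (h + m * l + k).-1| / `|delta R dig (h + m * l + k)|
  = `|delta R dp k.-1| / `|delta R dp k|.
Proof.
move=> k0; have -> : ((h + m * l + k).-1 = h + (m * l + k.-1))%N by lia.
have D i := delta_gt0 R i pure_digits_pos.
have E i : delta R dig (h + (m * l + i)) = (- delta R dig h * B ^+ m) * delta R dp i.
  by rewrite delta_proportional pure_delta_periodM mulrA.
rewrite -addnA !E !normrM -mulf_div mulfV ?mul1r// -normrM normr_eq0.
rewrite mulf_neq0 ?oppr_eq0 ?expf_neq0 ?const_b_neq0//.
by rewrite -normr_gt0 delta_gt0//; exact: cf_digits_pos.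
Qed.

Lemma cvg_inv_qdelta k : (1 <= k <= l)%N ->
  (fun m => ((cfq dig (h + m * l + k))%:R * `|delta R dig (h + m * l + k)|)^-1) @ \oo
  --> alpha_sigma R l a k + `|delta R dp k.-1| / `|delta R dp k|.
Proof.
move=> kl; have /andP[k1 _] := kl.
have -> : (fun m => ((cfq dig (h + m * l + k))%:R * `|delta R dig (h + m * l + k)|)^-1) =
  (fun m => (cfq dig (h + m * l + k).-1)%:R / (cfq dig (h + m * l + k))%:R
     + `|delta R dp k.-1| / `|delta R dp k|).
  apply/funext => m; rewrite -(delta_ratio m k1).
  have := delta_wronskian R (h + m * l + k).-1 cf_digits_pos.
  rewrite prednK; last by lia.
  set x := cfq _ _; set y := cfq _ _; set z := `|_|; set w := `|_| => W.
  have x0 : x%:R != 0 :> R.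
    by rewrite pnatr_eq0 gtn_eqF// /x (_ : (_ + k)%N = (h + m * l + k).-1.+1) ?cfq_gt0//;
      [exact: cf_digits_pos|lia].
  have w0 : w != 0 by rewrite gt_eqF// delta_gt0//; exact: cf_digits_pos.
  move: x%:R y%:R x0 W => {x y} x y x0 W.
  have -> : (x * w)^-1 = (x * z + y * w) / (x * w) by rewrite W mul1r.
  by field; rewrite x0 w0.
by apply: cvgD; [exact: cvg_reversal|exact: cvg_cst].
Qed.

End PeriodicDigits.

(** * Infinite products *)

Section InfiniteProducts.
Variable R : realType.
Implicit Types (f g : nat -> R) (M L : R).

(** The right side telescopes; the factor 2 comes from t + 1 <= 2 t. *)
Lemma inv_sqr_le (t : nat) : (0 < t)%N ->
  (t%:R ^+ 2)^-1 <= 2 * (t%:R^-1 - t.+1%:R^-1) :> R.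
Proof.
move=> t0; have t1 : 1 <= t%:R :> R by rewrite ler1n.
rewrite -[t.+1%:R]natr1; have -> : 2 * (t%:R^-1 - (t%:R + 1)^-1) = 2 / (t%:R * (t%:R + 1)) :> R.
  by field; rewrite !gt_eqF//; lra.
rewrite ler_pdivlMr; last by nra.
by rewrite mulrC ler_pdivrMr; nra.
Qed.

Lemma norm_prod_le f M N : 0 <= M ->
  (forall t, (0 < t <= N)%N -> `|f t| <= M / t%:R ^+ 2) ->
  `|\prod_(1 <= t < N.+1) (1 + f t)| <= expR (2 * M).
Proof.
(* The induction runs on the telescoped sum, which is sharper than the bound claimed. *)
move=> M0 fM; apply: (@le_trans _ _ (expR (2 * M * (1 - N.+1%:R^-1)))); last first.
  by rewrite ler_expR ler_piMr ?mulr_ge0// gerBl.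
elim: N fM => [|N IH] fM; first by rewrite big_geq// normr1 invr1 subrr mulr0 expR0.
rewrite big_nat_recr//= normrM.
have -> : 2 * M * (1 - N.+2%:R^-1) = 2 * M * (1 - N.+1%:R^-1)
   + 2 * M * (N.+1%:R^-1 - N.+2%:R^-1) by ring.
rewrite expRD ler_pM//; first by apply: IH => t /andP[t0 tN]; rewrite fM// t0 ltnW.
apply: le_trans (expR_ge1Dx _); apply: le_trans (ler_normD _ _) _.
rewrite normr1 lerD2l; apply: le_trans (fM _ _) _; first by rewrite ltnSn.
by rewrite [2 * M]mulrC -mulrA ler_wpM2l// inv_sqr_le.
Qed.

(** The bound depends on f only through M; this uniformity is what a family of products needs. *)
Lemma norm_prodB_le f M T N : 0 <= M -> (T <= N)%N ->
  (forall t, (0 < t <= N)%N -> `|f t| <= M / t%:R ^+ 2) ->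
  `|\prod_(1 <= t < N.+1) (1 + f t) - \prod_(1 <= t < T.+1) (1 + f t)|
  <= expR (2 * M) * M * 2 / T.+1%:R.
Proof.
move=> M0 TN fM.
apply: (@le_trans _ _ (expR (2 * M) * M * (2 * (T.+1%:R^-1 - N.+1%:R^-1)))); last first.
  by rewrite -!mulrA !ler_wpM2l// ?expR_ge0// gerBl.
elim: N TN fM => [|N IH].
  by rewrite leqn0 => /eqP-> _; rewrite !subrr normr0 !mulr0.
rewrite leq_eqVlt => /predU1P[-> _|]; first by rewrite !subrr normr0 !mulr0.
rewrite ltnS => TN fM.
have fM' t : (0 < t <= N)%N -> `|f t| <= M / t%:R ^+ 2.
  by move=> /andP[t0 tN]; rewrite fM// t0 ltnW.
rewrite big_nat_recr//=; set P := \prod_(_ <= _ < N.+1) _; set Q := \prod_(_ <= _ < _) _.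
have -> : P * (1 + f N.+1) - Q = P - Q + P * f N.+1 by ring.
apply: le_trans (ler_normD _ _) _.
have -> : 2 * (T.+1%:R^-1 - N.+2%:R^-1) = 2 * (T.+1%:R^-1 - N.+1%:R^-1)
  + 2 * (N.+1%:R^-1 - N.+2%:R^-1) :> R by ring.
rewrite mulrDr lerD//; first exact: IH.
rewrite normrM -[X in _ <= X]mulrA ler_pM//; first exact: norm_prod_le.
apply: le_trans (fM _ _) _; first by rewrite ltnSn.
by rewrite ler_wpM2l// inv_sqr_le.
Qed.

Lemma infprod_cvg f M : 0 <= M ->
  (forall t, (0 < t)%N -> `|f t| <= M / t%:R ^+ 2) ->
  exists L, infprod_to (fun t => 1 + f t) L.
Proof.
move=> M0 fM; suff : cvgn (fun T => \prod_(1 <= t < T.+1) (1 + f t)).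
  by move=> V; exists (limn (fun T => \prod_(1 <= t < T.+1) (1 + f t))).
apply: (@cvgn_tail_bound _ _ (expR (2 * M) * M * 2)) => n N /andP[n0 nN].
apply: le_trans (norm_prodB_le M0 nN _) _.
  by move=> t /andP[t0 _]; exact: fM.
by rewrite ler_wpM2l ?mulr_ge0 ?expR_ge0// lef_pV2 ?posrE ?ltr0n// ler_nat.
Qed.

(** Past an index T with 2 M / (T + 1) <= 1/2 the partial products keep at least half of |P_T|, by
    prod (1 - x_i) >= 1 - sum x_i with telescoped x_i. *)
Lemma infprod_neq0 f M L : 0 <= M ->
  (forall t, (0 < t)%N -> `|f t| <= M / t%:R ^+ 2) ->
  (forall t, (0 < t)%N -> 1 + f t != 0) ->
  infprod_to (fun t => 1 + f t) L -> L != 0.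
Proof.
move=> M0 fM f0 fL.
have e0 : 0 < (4 * (M + 1))^-1 by rewrite invr_gt0 mulr_gt0// ltr_wpDl.
have [T _ /(_ T (leqnn T)) /= HT] := @near_infty_natSinv_lt R (PosNum e0).
set P := fun N => \prod_(1 <= t < N.+1) (1 + f t).
have MT : 2 * M / T.+1%:R <= 2^-1.
  apply: (@le_trans _ _ (2 * M * (4 * (M + 1))^-1)).
    by rewrite ler_wpM2l ?mulr_ge0// ltW.
  by rewrite ler_pdivrMr; lra.
have PT : `|P T| != 0.
  rewrite normr_eq0 prodf_seq_neq0; apply/allP => t; rewrite mem_index_iota => /andP[t0 _].
  by rewrite f0.
have PN N : (T <= N)%N -> `|P T| * (1 - 2 * M * (T.+1%:R^-1 - N.+1%:R^-1)) <= `|P N|.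
  elim: N => [|N IH]; first by rewrite leqn0 => /eqP->; rewrite subrr mulr0 subr0 mulr1.
  rewrite leq_eqVlt => /predU1P[->|]; first by rewrite subrr mulr0 subr0 mulr1.
  rewrite ltnS => TN; rewrite /P [X in _ <= `|X|]big_nat_recr//= normrM -/(P N) -/(P T).
  have fN := fM N.+1 isT; have iN := @inv_sqr_le N.+1 isT.
  have gN : 1 - 2 * M * (N.+1%:R^-1 - N.+2%:R^-1) <= `|1 + f N.+1|.
    apply: (@le_trans _ _ (1 - `|f N.+1|)); last first.
      by rewrite -{1}(@normr1 R); apply: le_trans (lerB_normD _ _) _.
    rewrite lerD2l lerN2; apply: le_trans fN _.
    by rewrite [2 * M]mulrC -mulrA ler_wpM2l.
  have x0 : 0 <= T.+1%:R^-1 - N.+1%:R^-1 :> R.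
    by rewrite subr_ge0 lef_pV2 ?posrE ?ltr0n// ler_nat.
  have y0 : 0 <= N.+1%:R^-1 - N.+2%:R^-1 :> R.
    by rewrite subr_ge0 lef_pV2 ?posrE ?ltr0n// ler_nat.
  have z0 : 0 <= N.+2%:R^-1 :> R by rewrite invr_ge0.
  have w0 : 0 <= N.+1%:R^-1 :> R by rewrite invr_ge0.
  apply: le_trans (ler_pM _ _ (IH TN) gN).
  - rewrite -[X in _ <= X]mulrA ler_wpM2l//.
    set x := T.+1%:R^-1 in x0 MT *; set y := N.+1%:R^-1 in x0 y0 w0 *.
    set z := N.+2%:R^-1 in y0 z0 *.
    have : 0 <= M * (x - y) * (M * (y - z)) by rewrite !mulr_ge0.
    lra.
  - rewrite mulr_ge0//; have : 0 <= M * N.+1%:R^-1 by rewrite mulr_ge0.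
    by move: T.+1%:R^-1 N.+1%:R^-1 MT => x y MT; lra.
  - have : M * N.+1%:R^-1 <= M * T.+1%:R^-1 by rewrite ler_wpM2l// -subr_ge0.
    have : 0 <= M * N.+2%:R^-1 by rewrite mulr_ge0.
    by move: T.+1%:R^-1 N.+1%:R^-1 N.+2%:R^-1 MT => x y z MT; lra.
suff : `|P T| / 2 <= `|L|.
  by move=> PL; rewrite -normr_gt0 (lt_le_trans _ PL)// divr_gt0// lt_def PT/=.
apply: (cvgr_to_ge (cvg_norm fL)); exists T => // N /= TN; apply: le_trans (PN N TN).
rewrite ler_wpM2l//; have : 0 <= M * N.+1%:R^-1 by rewrite mulr_ge0.
by move: T.+1%:R^-1 N.+1%:R^-1 MT => x y MT; lra.
Qed.

Lemma cvg_prod_nat (F : nat -> nat -> R) (G : nat -> R) (m n : nat) :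
  (forall t, (m <= t)%N -> (F^~ t) @ \oo --> G t) ->
  (fun i => \prod_(m <= t < n) F i t) @ \oo --> \prod_(m <= t < n) G t.
Proof.
move=> FG; elim: n => [|n IH].
  by rewrite big_geq//; under eq_fun do rewrite big_geq//; exact: cvg_cst.
have [mn|nm] := leqP m n; last first.
  by rewrite big_geq//; under eq_fun do rewrite big_geq//; exact: cvg_cst.
rewrite big_nat_recr//=; under eq_fun do rewrite big_nat_recr//=.
by apply: cvgM => //; exact: FG.
Qed.

(* Tannery's theorem for products. *)
Lemma cvg_prod_dominated (F : nat -> nat -> R) (G : nat -> R) (N : nat -> nat) M L :
  0 <= M -> N @ \oo --> \oo ->
  (forall t, (0 < t)%N -> (F^~ t) @ \oo --> G t) ->
  (\forall m \near \oo, forall t, (0 < t <= N m)%N -> `|F m t| <= M / t%:R ^+ 2) ->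
  infprod_to (fun t => 1 + G t) L ->
  (fun m => \prod_(1 <= t < (N m).+1) (1 + F m t)) @ \oo --> L.
Proof.
move=> M0 Noo FG FM GL; apply/cvgrPdist_le => e e0.
(* The constant of [norm_prodB_le]: beyond T the products of [F m] change by at most K / (T + 1),
   for all large m at once. *)
pose K := expR (2 * M) * M * 2.
have K0 : 0 <= K by rewrite !mulr_ge0// expR_ge0.
have e30 : 0 < e / 3 by rewrite divr_gt0.
have /cvgrPdist_le/(_ _ e30)[T0 _ HT0] := GL.
have e3 : 0 < e / (3 * (K + 1)) by rewrite divr_gt0// mulr_gt0// ltr_wpDl.
have [T1 _ HT1] := @near_infty_natSinv_lt R (PosNum e3).
pose T := maxn T0 T1.
have KT : K / T.+1%:R <= e / 3.
  apply: (@le_trans _ _ (K * (e / (3 * (K + 1))))).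
    by rewrite ler_wpM2l// ltW//; apply: HT1; exact: leq_maxr.
  rewrite mulrA ler_pdivrMr ?mulr_gt0 ?ltr_wpDl//.
  have -> : e / 3 * (3 * (K + 1)) = K * e + e by field.
  by rewrite lerDl ltW.
have FT : (fun m => \prod_(1 <= t < T.+1) (1 + F m t)) @ \oo --> \prod_(1 <= t < T.+1) (1 + G t).
  by apply: cvg_prod_nat => t t0; apply: cvgD; [exact: cvg_cst|exact: FG].
have /cvgrPdist_le/(_ _ e30) H1 := FT.
have /cvgnyPge/(_ T) NT := Noo.
near=> m.
have TN : (T <= N m)%N by near: m.
have Fm : forall t, (0 < t <= N m)%N -> `|F m t| <= M / t%:R ^+ 2 by near: m.
apply: le_trans (ler_distD (\prod_(1 <= t < T.+1) (1 + G t)) _ _) _.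
have -> : e = e / 3 + (e / 3 + e / 3) by field.
apply: lerD; first by apply: HT0; exact: leq_maxl.
apply: le_trans (ler_distD (\prod_(1 <= t < T.+1) (1 + F m t)) _ _) _.
apply: lerD; first by near: m.
by apply: le_trans KT; rewrite distrC; exact: norm_prodB_le.
Unshelve. all: by end_near. Qed.

End InfiniteProducts.

(** * Sine and fractional part *)

Section Sine.
Variable R : realType.
Implicit Types (x y z : R).

Lemma sin_secant x : exists2 c, `|c| <= `|x| & sin x = cos c * x.
Proof.
wlog x0 : x / 0 <= x => [H|].
  have [/H//|/ltW x0] := leP 0 x.
  have [|c cx E] := H (- x); first by rewrite oppr_ge0.
  by exists c; [rewrite -[`|x|]normrN|apply: oppr_inj; rewrite -sinN E mulrN].
have [|c] := @MVT_segment R sin cos 0 x x0 (fun y _ => is_derive_sin y).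
  by apply: continuous_subspaceT => y; exact: continuous_sin.
rewrite in_itv/= sin0 !subr0 => /andP[c0 cx] E; exists c => //.
by rewrite !ger0_norm.
Qed.

Lemma norm_sin_le x : `|sin x| <= `|x|.
Proof.
have [c _ ->] := sin_secant x.
by rewrite normrM ler_piMl// cos_max.
Qed.

Lemma sqr_sin_le x : sin x ^+ 2 <= x ^+ 2.
Proof.
rewrite -[leLHS]real_normK ?num_real// -[leRHS]real_normK ?num_real//.
by rewrite lerXn2r ?nnegrE// norm_sin_le.
Qed.

Lemma cosB1_ge x : 1 - x ^+ 2 / 2 <= cos x.
Proof.
have -> : cos x = 1 - 2 * sin (x / 2) ^+ 2.
  have {1}-> : x = (x / 2) *+ 2 by rewrite -[RHS]mulr_natr divfK// pnatr_eq0.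
  by rewrite cos_mulr2n cos2sin2; ring.
rewrite lerD2l lerN2; apply: (@le_trans _ _ (2 * (x / 2) ^+ 2)).
  by rewrite ler_wpM2l// sqr_sin_le.
by rewrite le_eqVlt; apply/orP; left; apply/eqP; field.
Qed.

Lemma norm_sinB_le x : `|sin x - x| <= `|x| ^+ 3.
Proof.
have [c cx ->] := sin_secant x.
have -> : cos c * x - x = (cos c - 1) * x by ring.
rewrite normrM exprSr ler_wpM2r//.
rewrite ler0_norm ?subr_le0 ?cos_le1// opprB.
apply: (@le_trans _ _ (c ^+ 2)); last first.
  by rewrite -[c ^+ 2]real_normK ?num_real// lerXn2r ?nnegrE.
by have := cosB1_ge c; have := sqr_ge0 c; lra.
Qed.

(** The range goes past pi/2 because the angles of the folded product can slightly exceed it.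
    Halving brings them into [0, 1], where cos >= 1/2. *)
Lemma sin_ge_quarter x : 0 <= x <= 2 -> x / 4 <= sin x.
Proof.
move=> /andP[x0 x2].
have c2 y : 0 <= y <= 1 -> 2^-1 <= cos y.
  by move=> /andP[y0 y1]; have := cosB1_ge y; nra.
have s2 : x / 4 <= sin (x / 2).
  have [c] := sin_secant (x / 2).
  rewrite [X in _ <= X -> _]ger0_norm ?divr_ge0// -cos_norm => cx ->.
  have : 2^-1 <= cos `|c| by apply: c2; rewrite normr_ge0/=; lra.
  nra.
have -> : sin x = 2 * (cos (x / 2) * sin (x / 2)).
  by rewrite [RHS]mulr_natl -sin_mulr2n -[(x / 2) *+ 2]mulr_natr divfK// pnatr_eq0.
have : 2^-1 <= cos (x / 2) by apply: c2; lra.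
nra.
Qed.

Lemma norm_sinDpi x (z : int) : `|sin (x + pi * z%:~R)| = `|sin x|.
Proof.
have H (n : nat) y : `|sin (y + pi * n%:R)| = `|sin y|.
  by rewrite mulr_natr (alternatingn (@sinDpi R)) normrM normrX normrN1 expr1n mul1r.
case: z => n; first exact: H.
by rewrite NegzE mulrNz mulrN -(H n.+1 (x - _)) subrK.
Qed.

(** The error is at most |D|^2 |v|^3. The quotient is by D and not by D v because v may vanish, as
    for z = -1. *)
Lemma cvg_sin_ratio (D v : nat -> R) (v0 : R) :
  (forall n, D n != 0) -> D @ \oo --> (0 : R) -> v @ \oo --> v0 ->
  (fun n => sin (D n * v n) / D n) @ \oo --> v0.
Proof.
move=> D0 Dc vc.
have -> : (fun n => sin (D n * v n) / D n) =
   (fun n => v n + (sin (D n * v n) / D n - v n)).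
  by apply/funext => n; ring.
rewrite -[v0]addr0; apply: cvgD; first exact: vc.
apply/norm_cvg0P.
have V : (fun n => `|D n| * `|D n| * (`|v n| * `|v n| * `|v n|)) @ \oo
    --> `|0 : R| * `|0 : R| * (`|v0| * `|v0| * `|v0|).
  by apply: cvgM; repeat apply: cvgM; exact: cvg_norm.
rewrite normr0 !mul0r in V; apply: (@squeeze_cvgr _ _ _ _ (fun=> 0) _ _ _ _ _ V); last exact: cvg_cst.
apply: nearW => n; rewrite normr_ge0/=.
have -> : sin (D n * v n) / D n - v n = (sin (D n * v n) - D n * v n) / D n.
  by field.
rewrite normrM normfV ler_pdivrMr ?normr_gt0//.
apply: le_trans (norm_sinB_le _) _; rewrite normrM.
by rewrite le_eqVlt; apply/orP; left; apply/eqP; ring.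
Qed.

Lemma fractE x y (z : int) : x = z%:~R + y -> 0 <= y < 1 -> fract x = y.
Proof.
move=> -> /andP[y0 y1].
have E : Num.floor (z%:~R + y) = z.
  by apply: floor_def; rewrite intrD lerDl y0 ltrD2l.
by rewrite /fract E addrAC subrr add0r.
Qed.

Lemma fract_itv x : 0 <= fract x < 1.
Proof.
by have /andP[] := floor_itv x; rewrite /fract intrD => *; apply/andP; split; lra.
Qed.

Lemma fract_natdiv (m n : nat) : (0 < n)%N ->
  fract (m%:R / n%:R) = (m %% n)%:R / n%:R :> R.
Proof.
move=> n0; have n1 : 0 < n%:R :> R by rewrite ltr0n.
apply: (@fractE _ _ (m %/ n)%N).
  by rewrite {1}(divn_eq m n) natrD natrM pmulrn; field; rewrite gt_eqF.
by rewrite divr_ge0//= ltr_pdivrMr// mul1r ltr_nat ltn_pmod.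
Qed.

(** Away from integers the floor is eventually constant; the irrationality of [alpha_sigma] is
    proved for this purpose. *)
Lemma cvg_fract (x : nat -> R) y : (forall z : int, y != z%:~R) ->
  x @ \oo --> y -> (fun n => fract (x n)) @ \oo --> fract y.
Proof.
move=> yz xy; have /andP[y0 y1] := floor_itv y.
have {}y0 : (Num.floor y)%:~R < y by rewrite lt_neqAle eq_sym yz.
have V : (fun n => x n - (Num.floor y)%:~R) @ \oo --> fract y.
  by apply: cvgB => //; exact: cvg_cst.
apply: cvg_trans V; apply: near_eq_cvg.
near=> n; rewrite /fract; congr (_ - _%:~R).
apply/esym/floor_def; apply/andP; split.
  by apply/ltW; near: n; exact: (cvgr_gt y).
by near: n; exact: (cvgr_lt y).
Unshelve. all: by end_near. Qed.

End Sine.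

(** * Shifted Sudler products *)

Section ShiftedSudler.
Variables (R : realType) (d : nat -> nat).
Hypothesis d_gt0 : pos_digits d.
Local Notation x := (cf_value R d).
Local Notation q := (cfq d).
Local Notation p := (cfp d).
Local Notation dl := (delta R d).

Definition shifted_sudler (N : nat) (y : R) : R :=
  \prod_(1 <= r < N.+1) `|2 * sin (pi * (r%:R * x + y))|.

Lemma shifted_sudler0 N : shifted_sudler N 0 = sudler N x.
Proof. by apply: eq_bigr => r _; rewrite addr0 mulrA. Qed.

Lemma norm_sin_shift (y : R) (z : int) : `|sin (pi * (y + z%:~R))| = `|sin (pi * y)|.
Proof. by rewrite mulrDr norm_sinDpi. Qed.

(* q_n x = p_n + delta_n, and integer shifts do not change the factors. *)
Lemma shifted_sudlerD n M y : shifted_sudler (q n + M) y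
  = shifted_sudler (q n) y * shifted_sudler M (y + dl n).
Proof.
rewrite /shifted_sudler; elim: M => [|M IH].
  by rewrite addn0 [X in _ = _ * X]big_geq// mulr1.
rewrite addnS big_nat_recr//= IH -mulrA; congr (_ * _).
rewrite [RHS]big_nat_recr//=; congr (_ * _).
rewrite !normrM -(norm_sin_shift (M.+1%:R * x + (y + dl n)) (p n)) -addnS natrD.
by congr (_ * `|sin (pi * _)|); rewrite /delta -pmulrn; ring.
Qed.

Lemma shifted_sudlerM n c y : shifted_sudler (c * q n) y
  = \prod_(0 <= s < c) shifted_sudler (q n) (y + s%:R * dl n).
Proof.
elim: c y => [|c IH] y; first by rewrite mul0n /shifted_sudler !big_geq.
rewrite mulSn shifted_sudlerD IH big_nat_recl//= mul0r addr0; congr (_ * _).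
by apply: eq_bigr => s _; rewrite -natr1; congr shifted_sudler; ring.
Qed.

Lemma coprime_cfq n : coprime (q n.+1) (q n).
Proof.
elim: n => [|n IH]; first by rewrite coprime1n.
by rewrite /coprime cfqSS gcdnC gcdnMDl.
Qed.

Section Reindex.
Variable n : nat.
Hypothesis n_gt0 : (0 < n)%N.
Local Notation Q := (q n).
Local Notation Q' := (q n.-1).

Lemma cfq_n_gt0 : (0 < Q)%N.
Proof. by rewrite -(prednK n_gt0) cfq_gt0. Qed.

(* residue t * p_n is congruent to (-1)^n t modulo q_n. *)
Definition residue t := (t * Q' %% Q)%N.

Lemma residue_itv t : (0 < t < Q)%N -> (0 < residue t < Q)%N.
Proof.
move=> /andP[t0 tQ]; rewrite ltn_pmod ?cfq_n_gt0// andbT lt0n.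
have := coprime_cfq n.-1; rewrite prednK// => co.
by rewrite -/(dvdn Q (t * Q')) Gauss_dvdl//; apply/negP => /dvdn_leq; lia.
Qed.

Lemma residue_inj t s : (0 < t < Q)%N -> (0 < s < Q)%N ->
  residue t = residue s -> t = s.
Proof.
wlog ts : t s / (s <= t)%N => [H tQ sQ|].
  have [st|/ltnW ts] := leqP s t; first exact: H.
  by move=> E; apply/esym/H.
move=> /andP[t0 tQ] /andP[s0 sQ] /eqP; have := coprime_cfq n.-1; rewrite prednK// => co.
rewrite /residue eqn_mod_dvd ?leq_mul2r ?ts ?orbT//.
rewrite -mulnBl Gauss_dvdl// => D.
have [|ts0] := posnP (t - s)%N; first by lia.
by have := dvdn_leq ts0 D; lia.
Qed.

Lemma prod_residue (F : nat -> R) :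
  \prod_(1 <= r < Q) F r = \prod_(1 <= t < Q) F (residue t).
Proof.
rewrite -(big_map residue xpredT F); apply: perm_big.
have U : uniq (map residue (index_iota 1 Q)).
  rewrite map_inj_in_uniq ?iota_uniq// => t s.
  by rewrite !mem_index_iota; exact: residue_inj.
apply: uniq_perm => //; first exact: iota_uniq.
have [||_ E r] := uniq_min_size U (s2 := index_iota 1 Q); last by rewrite E.
  by move=> r /mapP[t]; rewrite !mem_index_iota => /residue_itv H ->.
by rewrite size_map.
Qed.

Lemma residueN t : (0 < t < Q)%N -> residue (Q - t) = (Q - residue t)%N.
Proof.
move=> tQ; have := residue_itv tQ; set r := residue t => /andP[r0 rQ].
have /residue_itv : (0 < Q - t < Q)%N by lia.
have : (residue (Q - t) + residue t = 0 %[mod Q])%N.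
  by rewrite modnDmr modnDml -mulnDl subnK ?modnMr ?mod0n//; lia.
rewrite mod0n -/r => /eqP; rewrite -/(dvdn _ _) => /dvdnP[[|[|k]]]; nia.
Qed.

(* Converges to u_k(t) along n = h + m l + k. *)
Definition node (t : nat) : R :=
  2 * (t%:R / (Q%:R * `|dl n|) - fract (t%:R * (Q'%:R / Q%:R)) + 1 / 2).

(** Angles in units of pi |delta_n| / 2. As the unit tends to 0, quotients of sines become quotients
    of the v, that is, of 1 + 2 z and the nodes. *)
Definition arg (v : R) : R := pi * `|dl n| / 2 * v.

Lemma nodeE t : node t = 2 * (t%:R / (Q%:R * `|dl n|) - (residue t)%:R / Q%:R + 1 / 2).
Proof. by rewrite /node mulrA -natrM fract_natdiv// cfq_n_gt0. Qed.

(** By p_n q_(n-1) = p_(n-1) q_n + (-1)^n, the number r x with r = [residue t] is (-1)^n t / q_n + r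
    delta_n / q_n modulo 1. Subtracting delta_n / 2 and factoring out |delta_n| / 2 leaves the node
    up to sign. *)
Lemma sqr_sin_node t :
  sin (pi * ((residue t)%:R * x - dl n / 2)) ^+ 2 = sin (arg (node t)) ^+ 2.
Proof.
have Q0 : Q%:R != 0 :> R by rewrite pnatr_eq0 gtn_eqF// cfq_n_gt0.
have sq (u v : R) : `|u| = `|v| -> u ^+ 2 = v ^+ 2.
  by move=> uv; rewrite -[u ^+ 2]real_normK ?num_real// uv real_normK ?num_real.
apply: sq.
have D0 : `|dl n| != 0 by rewrite gt_eqF// delta_gt0.
have DE : dl n = - (-1) ^+ n * `|dl n|.
  by rewrite delta_norm// mulNr mulrN opprK mulrA -expr2 sqrr_sign mul1r.
have xE : x = ((p n)%:R + dl n) / Q%:R by rewrite /delta; field.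
have detE : (p n)%:R * Q'%:R = (p n.-1)%:R * Q%:R + (-1) ^+ n :> R.
  have sE : (-1) ^+ n = - (-1) ^+ n.-1 :> R.
    by case: (n) n_gt0 => // m _; rewrite exprS mulN1r.
  by have := cf_det R d n.-1; rewrite prednK// sE => <-; ring.
pose j := (t * Q' %/ Q)%N.
have rE : (residue t)%:R = t%:R * Q'%:R - j%:R * Q%:R :> R.
  by rewrite -!natrM {1}(divn_eq (t * Q') Q) natrD addrC addKr.
have E : (residue t)%:R * x - dl n / 2
   = (-1) ^+ n * (`|dl n| / 2 * node t) + (t%:Z * (p n.-1)%:Z - j%:Z * (p n)%:Z)%:~R.
  rewrite xE mulrA mulrDr {1}rE.
  have -> : (t%:R * Q'%:R - j%:R * Q%:R) * (p n)%:R
     = t%:R * ((p n.-1)%:R * Q%:R + (-1) ^+ n) - j%:R * Q%:R * (p n)%:R :> R.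
    by rewrite -detE; ring.
  rewrite rmorphB !rmorphM /= -!pmulrn nodeE {1 2}DE; field.
  by rewrite Q0.
rewrite E norm_sin_shift /arg mulrCA.
have -> : pi * `|dl n| / 2 * node t = pi * (`|dl n| / 2 * node t) by ring.
rewrite -signr_odd; case: (odd n); rewrite ?expr1 ?expr0 ?mulN1r ?mul1r//.
by rewrite sinN normrN.
Qed.

Lemma sin_mul (X Y : R) : sin (Y + X) * sin (Y - X) = sin Y ^+ 2 - sin X ^+ 2.
Proof.
rewrite sinD sinB.
have -> : (sin Y * cos X + cos Y * sin X) * (sin Y * cos X - cos Y * sin X)
  = sin Y ^+ 2 * cos X ^+ 2 - cos Y ^+ 2 * sin X ^+ 2 by ring.
by rewrite !cos2sin2; ring.
Qed.

(** As q_n x = p_n + delta_n, the points r x and (q_n - r) x are symmetric about delta_n / 2 modulo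
    1. The angles are therefore Y + X and Y - X, where only Y involves z. *)
Lemma pair_factor (z : R) t : (0 < t < Q)%N ->
  `|2 * sin (pi * ((residue t)%:R * x + z * dl n))|
  * `|2 * sin (pi * ((residue (Q - t))%:R * x + z * dl n))|
  = 4 * `|sin (arg (node t)) ^+ 2 - sin (arg (1 + 2 * z)) ^+ 2|.
Proof.
move=> tQ; have /andP[_ /ltnW rQ] := residue_itv tQ.
rewrite residueN// natrB// !normrM normr_nat.
set X := pi * ((residue t)%:R * x - dl n / 2).
pose Y := pi * (dl n / 2 * (1 + 2 * z)).
have -> : pi * ((residue t)%:R * x + z * dl n) = Y + X by rewrite /X /Y; field.
have -> : (Q%:R - (residue t)%:R) * x + z * dl n
   = (dl n + z * dl n - (residue t)%:R * x) + (p n)%:Z%:~R.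
  by rewrite -pmulrn /delta; ring.
rewrite norm_sin_shift.
have -> : pi * (dl n + z * dl n - (residue t)%:R * x) = Y - X.
  by rewrite /X /Y; field.
rewrite mulrACA -natrM -normrM sin_mul sqr_sin_node distrC; congr (_ * `|_ - _|).
rewrite /Y /arg; have [d0|d0] := leP 0 (dl n).
  by rewrite (ger0_norm d0); congr (sin _ ^+ 2); field.
by rewrite (ltr0_norm d0) -[LHS]sqrrN -sinN; congr (sin _ ^+ 2); field.
Qed.

Definition gap_prod (z : R) : R := \prod_(1 <= r < Q) `|2 * sin (pi * (r%:R * x + z * dl n))|.

Definition sin_gap (z : R) (t : nat) : R :=
  4 * `|sin (arg (node t)) ^+ 2 - sin (arg (1 + 2 * z)) ^+ 2|.

Lemma sin_gapN z t : (0 < t < Q)%N -> sin_gap z (Q - t) = sin_gap z t.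
Proof.
move=> tQ; rewrite /sin_gap -!pair_factor//; last by lia.
by rewrite subKn 1?mulrC//; lia.
Qed.

(** Multiplying the product by its own reversal makes every pair occur twice, so the parity of q_n
    does not matter. *)
Lemma sqr_gap_prod z : gap_prod z ^+ 2 = \prod_(1 <= t < Q) sin_gap z t.
Proof.
rewrite /gap_prod [X in X ^+ 2]prod_residue expr2 [X in _ * X]big_nat_rev/= -big_split/=.
apply: eq_big_nat => t tQ.
by rewrite add1n subSS pair_factor.
Qed.

(** Folding keeps t <= N/2, which keeps the angles away from the zero of the sine at pi. There are
    two lengths because for even N the middle index is its own mirror image and counts once. *)
Lemma prod_symmetric (F : nat -> R) (N : nat) : (0 < N)%N ->
  (forall t, (0 < t < N)%N -> F (N - t)%N = F t) ->
  \prod_(1 <= t < N) F t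
  = \prod_(1 <= t < (N./2).+1) F t * \prod_(1 <= t < (N.-1./2).+1) F t.
Proof.
move=> N0 FN; have NE : N = (N./2 + N.-1./2).+1 by lia.
set K1 := N./2 in NE *; set K2 := N.-1./2 in NE *.
rewrite (big_cat_nat (n := K1.+1))//=; last by lia.
congr (_ * _); rewrite -add1n big_addn [RHS]big_nat_rev/=.
have -> : (N - K1 = K2.+1)%N by lia.
apply: eq_big_nat => t tK; rewrite -FN; last by lia.
by congr F; lia.
Qed.

(** The subtracted 1 gives the factors the form 1 + f required by [cvg_prod_dominated]. *)
Definition sin_quot (z : R) (t : nat) : R :=
  `|1 - sin (arg (1 + 2 * z)) ^+ 2 / sin (arg (node t)) ^+ 2| - 1.

Definition quot_prod (z : R) (K : nat) : R := \prod_(1 <= t < K.+1) (1 + sin_quot z t).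

Hypothesis delta_small : pi * (1 + `|dl n|) <= 4.

Lemma qdelta_gt0 : 0 < Q%:R * `|dl n|.
Proof. by rewrite mulr_gt0 ?ltr0n ?cfq_n_gt0// delta_gt0. Qed.

Lemma qdelta_le1 : Q%:R * `|dl n| <= 1.
Proof.
apply: le_trans (delta_le R d_gt0 n_gt0); rewrite mulrC ler_wpM2l// ler_nat.
exact: cfq_le_succ.
Qed.

Lemma arg_le u v : (arg u <= arg v) = (u <= v).
Proof. by rewrite /arg ler_pM2l// divr_gt0// mulr_gt0 ?pi_gt0// delta_gt0. Qed.

Lemma node_ge t : (0 < t)%N -> t%:R <= node t.
Proof.
move=> t0; have t1 : 1 <= t%:R :> R by rewrite ler1n.
have H : t%:R <= t%:R / (Q%:R * `|dl n|).
  by rewrite ler_pdivlMr ?qdelta_gt0// ler_piMr// qdelta_le1.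
have /andP[_ F1] := fract_itv (t%:R * (Q'%:R / Q%:R) : R).
by rewrite /node; lra.
Qed.

(** For t <= q/2 the angle is at most pi (1 + |delta_n|) / 2; [delta_small] is chosen to make this
    at most 2. *)
Lemma arg_node_le t : (t <= Q./2)%N -> arg (node t) <= 2.
Proof.
move=> tK; have Q0 : 0 < Q%:R :> R by rewrite ltr0n cfq_n_gt0.
have D0 : 0 < `|dl n| by rewrite delta_gt0.
have tQ : t%:R / Q%:R <= 2^-1 :> R.
  by rewrite ler_pdivrMr// mulrC ler_pdivlMr// -natrM ler_nat; lia.
have /andP[F0 _] := fract_itv (t%:R * (Q'%:R / Q%:R) : R).
apply: (@le_trans _ _ (arg (2 * (t%:R / (Q%:R * `|dl n|) + 1 / 2)))).
  by rewrite arg_le /node; lra.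
have -> : arg (2 * (t%:R / (Q%:R * `|dl n|) + 1 / 2)) = pi * (t%:R / Q%:R + `|dl n| / 2).
  by rewrite /arg; field; rewrite !gt_eqF.
apply: (@le_trans _ _ (pi * (2^-1 + `|dl n| / 2))).
  by rewrite ler_wpM2l ?pi_ge0// lerD2r.
by move: delta_small; lra.
Qed.

Lemma node_gt0 t : (0 < t)%N -> 0 < node t.
Proof. by move=> t0; apply: lt_le_trans (node_ge t0); rewrite ltr0n. Qed.

Lemma arg_node_gt0 t : (0 < t)%N -> 0 < arg (node t).
Proof.
move=> t0; apply: mulr_gt0; last exact: node_gt0.
by rewrite divr_gt0// mulr_gt0 ?pi_gt0// delta_gt0.
Qed.

Lemma sin_arg_node t : (0 < t <= Q./2)%N -> arg (node t) / 4 <= sin (arg (node t)).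
Proof.
by move=> /andP[t0 tK]; apply: sin_ge_quarter; rewrite arg_node_le// andbT ltW// arg_node_gt0.
Qed.

Lemma sin_node_gt0 t : (0 < t <= Q./2)%N -> 0 < sin (arg (node t)).
Proof.
move=> tK; apply: lt_le_trans (sin_arg_node tK); rewrite divr_gt0// arg_node_gt0//.
by case/andP: tK.
Qed.

(** The numerator uses |sin v| <= |v|, the denominator sin v >= v / 4, whence 16; the unit of the
    angle cancels and the node is at least t. The bound is uniform in n. *)
Lemma sin_quot_le z t : (0 < t <= Q./2)%N ->
  `|sin_quot z t| <= 16 * (1 + 2 * z) ^+ 2 / t%:R ^+ 2.
Proof.
move=> tK; have /andP[t0 _] := tK; have sX := sin_node_gt0 tK.
have t1 : 0 < t%:R :> R by rewrite ltr0n.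
have aN := arg_node_gt0 t0.
set w := sin (arg (1 + 2 * z)) ^+ 2 / sin (arg (node t)) ^+ 2.
have w0 : 0 <= w by rewrite divr_ge0// sqr_ge0.
apply: (@le_trans _ _ w).
  rewrite /sin_quot -/w; have [w1|w1] := leP 0 (1 - w).
    by rewrite (ger0_norm w1) addrAC subrr add0r normrN ger0_norm.
  by rewrite (ltr0_norm w1) ler_norml; apply/andP; split; lra.
apply: (@le_trans _ _ (arg (1 + 2 * z) ^+ 2 / (arg (node t) / 4) ^+ 2)).
  rewrite ler_pM ?sqr_ge0 ?invr_ge0 ?sqr_ge0 ?sqr_sin_le// lef_pV2 ?posrE ?exprn_gt0 ?divr_gt0//.
  by apply: lerXn2r; rewrite ?nnegrE ?sin_arg_node// ltW// divr_gt0.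
have -> : arg (1 + 2 * z) ^+ 2 / (arg (node t) / 4) ^+ 2 = 16 * (1 + 2 * z) ^+ 2 / node t ^+ 2.
  have := node_gt0 t0; have := delta_gt0 R n d_gt0; have := pi_gt0 R; rewrite /arg.
  move: (node t) `|dl n| pi => N D P P0 D0 N0.
  by field; rewrite !gt_eqF.
have N0 := node_gt0 t0.
apply: ler_wpM2l; first by rewrite mulr_ge0 ?sqr_ge0.
rewrite lef_pV2 ?posrE; try exact: exprn_gt0.
by apply: lerXn2r; rewrite ?nnegrE ?node_ge// ltW.
Qed.

Lemma sin_gapE z t : (0 < t <= Q./2)%N ->
  sin_gap z t = 4 * sin (arg (node t)) ^+ 2 * (1 + sin_quot z t).
Proof.
move=> tK; have := sin_node_gt0 tK; set X := sin _ => X0.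
rewrite /sin_gap /sin_quot -/X -mulrA; congr (4 * _).
set w := `|1 - _|; have -> : 1 + (w - 1) = w by rewrite addrCA subrr addr0.
rewrite -[X in X * w]ger0_norm ?sqr_ge0// -normrM; congr `|_|.
by field; rewrite gt_eqF.
Qed.

(** The squared sines of the nodes, collected in S, do not depend on z and appear equally on both
    sides. *)
Lemma gap_prod_quot z : gap_prod z ^+ 2 * (quot_prod 0 Q./2 * quot_prod 0 Q.-1./2)
  = gap_prod 0 ^+ 2 * (quot_prod z Q./2 * quot_prod z Q.-1./2).
Proof.
pose S K : R := \prod_(1 <= t < K.+1) (4 * sin (arg (node t)) ^+ 2).
have E y K : (K <= Q./2)%N -> \prod_(1 <= t < K.+1) sin_gap y t = S K * quot_prod y K.
  move=> KQ; rewrite /S /quot_prod -big_split/=; apply: eq_big_nat => t /andP[t0 tK].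
  by rewrite sin_gapE// t0; lia.
have P y : gap_prod y ^+ 2 = S Q./2 * quot_prod y Q./2 * (S Q.-1./2 * quot_prod y Q.-1./2).
  rewrite sqr_gap_prod prod_symmetric ?cfq_n_gt0//; last by move=> t; exact: sin_gapN.
  by rewrite E// E// half_leq// leq_pred.
rewrite !P; move: (S _) (S _) (quot_prod _ _) (quot_prod _ _) (quot_prod _ _) (quot_prod _ _).
by move=> *; ring.
Qed.

(** The factor r = q_n has no partner; it is the source of the factor |1 + z| in kappa. *)
Lemma shifted_sudler_last z :
  shifted_sudler Q (z * dl n) = gap_prod z * `|2 * sin (arg (2 * (1 + z)))|.
Proof.
rewrite /shifted_sudler big_nat_recr ?cfq_n_gt0//=; congr (_ * _); rewrite !normrM; congr (_ * _).
have -> : Q%:R * x + z * dl n = dl n * (1 + z) + (p n)%:Z%:~R.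
  by rewrite -pmulrn /delta; ring.
rewrite norm_sin_shift /arg; have [d0|d0] := leP 0 (dl n).
  by rewrite (ger0_norm d0); congr `|sin _|; field.
by rewrite (ltr0_norm d0) -[LHS]normrN -sinN; congr `|sin _|; field.
Qed.

Lemma shifted_sudler_quot z :
  shifted_sudler Q (z * dl n) ^+ 2
    * (quot_prod 0 Q./2 * quot_prod 0 Q.-1./2 * sin (arg 2) ^+ 2)
  = sudler Q x ^+ 2
    * (quot_prod z Q./2 * quot_prod z Q.-1./2 * sin (arg (2 * (1 + z))) ^+ 2).
Proof.
rewrite -shifted_sudler0 -[X in shifted_sudler _ X ^+ 2 * (_ * sin (arg (2 * (1 + z))) ^+ 2)](mul0r (dl n)).
rewrite !shifted_sudler_last addr0 mulr1 !exprMn !real_normK ?num_real// !exprMn.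
have := gap_prod_quot z; move: (gap_prod z ^+ 2) (gap_prod 0 ^+ 2) => g1 g0.
move: (quot_prod 0 _ * _) (quot_prod z _ * _) => W0 W1 E.
transitivity (g1 * W0 * (2 ^+ 2 * sin (arg (2 * (1 + z))) ^+ 2 * sin (arg 2) ^+ 2)).
  by ring.
by rewrite E; ring.
Qed.

End Reindex.
End ShiftedSudler.

(** * Ratios of shifted products in the limit *)

Section SudlerLimit.
Variables (R : realType) (d : nat -> nat) (nn : nat -> nat) (lam rho : R).
Hypothesis d_gt0 : pos_digits d.
Hypothesis nn_ge : forall m, (m <= nn m)%N.
Hypothesis nn_gt0 : forall m, (0 < nn m)%N.
Local Notation x := (cf_value R d).
Local Notation q := (cfq d).
Local Notation dl := (delta R d).
Hypothesis cvg_lam : (fun m => (q (nn m))%:R * `|dl (nn m)|) @ \oo --> lam.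
Hypothesis lam_gt0 : 0 < lam.
Hypothesis cvg_rho : (fun m => (q (nn m).-1)%:R / (q (nn m))%:R) @ \oo --> rho.
Hypothesis rho_irr : forall (t : nat) (z : int), (0 < t)%N -> t%:R * rho != z%:~R.

Definition limit_node (t : nat) : R := 2 * (t%:R / lam - fract (t%:R * rho) + 1 / 2).
Hypothesis limit_node_ge : forall t, (0 < t)%N -> 2 * t%:R + 1 <= limit_node t.

Definition limit_quot (z : R) (t : nat) : R := `|1 - (1 + 2 * z) ^+ 2 / limit_node t ^+ 2|.

Lemma cvg_node t : (0 < t)%N -> (fun m => node R d (nn m) t) @ \oo --> limit_node t.
Proof.
move=> t0; rewrite /node /limit_node; apply: cvgM; first exact: cvg_cst.
apply: cvgD; last exact: cvg_cst.
apply: cvgB.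
  apply: cvgM; first exact: cvg_cst.
  by apply: cvgV => //; rewrite gt_eqF.
apply: cvg_fract; first by move=> z; exact: rho_irr.
by apply: cvgM => //; exact: cvg_cst.
Qed.

Lemma cvg_delta_nn : (fun m => `|dl (nn m)|) @ \oo --> (0 : R).
Proof.
rewrite -[X in _ --> X](@normr0 R R).
by apply: cvg_norm; apply: (@cvg_subseq R (delta R d) 0 nn) => //; exact: cvg_delta.
Qed.

Let D m : R := pi * `|dl (nn m)| / 2.

Lemma scale_neq0 m : D m != 0.
Proof. by rewrite gt_eqF// divr_gt0// mulr_gt0 ?pi_gt0 ?delta_gt0. Qed.

Lemma cvg_scale : D @ \oo --> (0 : R).
Proof.
have -> : (0 : R) = pi * 0 / 2 by rewrite mulr0 mul0r.
apply: cvgM; last exact: cvg_cst.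
by apply: cvgM; [exact: cvg_cst|exact: cvg_delta_nn].
Qed.

Lemma near_delta_small : \forall m \near \oo, pi * (1 + `|dl (nn m)|) <= 4 :> R.
Proof.
have V : (fun m => pi * (1 + `|dl (nn m)|)) @ \oo --> (pi * (1 + 0) : R).
  apply: cvgM; first exact: cvg_cst.
  by apply: cvgD; [exact: cvg_cst|exact: cvg_delta_nn].
have P : (pi * (1 + 0) : R) < 4.
  by rewrite addr0 mulr1; have := pihalf_lt2 R; lra.
by near do apply: ltW; exact: (cvgr_lt _ V).
Unshelve. all: by end_near. Qed.

Lemma limit_node_gt0 t : (0 < t)%N -> 0 < limit_node t.
Proof. by move=> t0; apply: lt_le_trans (limit_node_ge t0); rewrite ltr_wpDl// mulr_ge0. Qed.

Lemma cvg_scaled_sin (v : nat -> R) (v0 : R) : v @ \oo --> v0 ->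
  (fun m => sin (arg d (nn m) (v m)) / D m) @ \oo --> v0.
Proof. by move=> vv; apply: (cvg_sin_ratio scale_neq0 cvg_scale vv). Qed.

Lemma cvg_sin_quot z t : (0 < t)%N ->
  (fun m => sin_quot d (nn m) z t) @ \oo --> limit_quot z t - 1.
Proof.
move=> t0; rewrite /sin_quot /limit_quot; apply: cvgB; last exact: cvg_cst.
apply: cvg_norm; apply: cvgB; first exact: cvg_cst.
have -> : (fun m => sin (arg d (nn m) (1 + 2 * z)) ^+ 2 / sin (arg d (nn m) (node R d (nn m) t)) ^+ 2)
  = (fun m => (sin (arg d (nn m) (1 + 2 * z)) / D m) * (sin (arg d (nn m) (1 + 2 * z)) / D m)
     / ((sin (arg d (nn m) (node R d (nn m) t)) / D m)
        * (sin (arg d (nn m) (node R d (nn m) t)) / D m))).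
  apply/funext => m; have := scale_neq0 m.
  move: (sin _) (sin _) (D m) => b a e e0.
  have E : a / e / (b / e) = a / b.
    by rewrite invf_div mulrA divfK.
  by rewrite -[RHS]mulf_div E expr2 expr2 mulf_div.
rewrite !expr2; apply: cvgM.
  by apply: cvgM; apply: cvg_scaled_sin; exact: cvg_cst.
apply: cvgV; first by rewrite mulf_neq0// gt_eqF// limit_node_gt0.
by apply: cvgM; apply: cvg_scaled_sin; exact: cvg_node.
Qed.

(** For fixed t the uniform bound applies once 2 t <= q, and it survives the limit. *)
Lemma limit_quotB1_le z t : (0 < t)%N ->
  `|limit_quot z t - 1| <= 16 * (1 + 2 * z) ^+ 2 / t%:R ^+ 2.
Proof.
move=> t0.
have V : (fun m => `|sin_quot d (nn m) z t|) @ \oo --> `|limit_quot z t - 1|.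
  by apply: cvg_norm; exact: cvg_sin_quot.
apply: (cvgr_to_le V).
near=> m; apply: sin_quot_le => //; first by near: m; exact: near_delta_small.
rewrite t0/=; apply: (@leq_trans (2 * t)./2); first by rewrite mul2n doubleK.
apply: half_leq; near: m; exists (2 * t).+1 => // m /= tm.
have := leq_cfq (nn m).-1 d_gt0; rewrite prednK//; have := nn_ge m; lia.
Unshelve. all: by end_near. Qed.

Lemma cvg_half_cfq : (fun m => (q (nn m))./2) @ \oo --> \oo.
Proof.
apply/cvgnyPge => N; exists (2 * N).+1 => // m /= Nm.
have := leq_cfq (nn m).-1 d_gt0; rewrite prednK//; have := nn_ge m; lia.
Qed.

Lemma cvg_half_pred_cfq : (fun m => (q (nn m)).-1./2) @ \oo --> \oo.
Proof.
apply/cvgnyPge => N; exists (2 * N).+2 => // m /= Nm.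
have := leq_cfq (nn m).-1 d_gt0; rewrite prednK//; have := nn_ge m; lia.
Qed.

Lemma infprod_limit_quot z (L : R) :
  infprod_to (limit_quot z) L <-> infprod_to (fun t => 1 + (limit_quot z t - 1)) L.
Proof.
have -> // : (fun t => 1 + (limit_quot z t - 1)) = limit_quot z.
by apply/funext => t; rewrite addrCA subrr addr0.
Qed.

Lemma infprod_limit_quot_cvg z : exists L : R, infprod_to (limit_quot z) L.
Proof.
have M0 : 0 <= 16 * (1 + 2 * z) ^+ 2 by rewrite mulr_ge0// sqr_ge0.
have [L HL] := infprod_cvg M0 (limit_quotB1_le z).
by exists L; apply/infprod_limit_quot.
Qed.

Lemma infprod_limit_quot_neq0 z L : (forall t, (0 < t)%N -> limit_quot z t != 0) ->
  infprod_to (limit_quot z) L -> L != 0.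
Proof.
move=> z0 /infprod_limit_quot.
apply: (@infprod_neq0 _ _ (16 * (1 + 2 * z) ^+ 2)).
- by rewrite mulr_ge0// sqr_ge0.
- exact: limit_quotB1_le.
- by move=> t t0; rewrite addrCA subrr addr0 z0.
Qed.

Lemma infprod_limit_quot_ge0 z L : infprod_to (limit_quot z) L -> 0 <= L.
Proof.
move=> H; apply: (cvgr_to_ge H); apply: nearW => T.
by apply: prodr_ge0 => t _; exact: normr_ge0.
Qed.

(** Every node is at least 3, so the range -2 < z < 1 is free of zeros; it contains 0 and B^2. *)
Lemma limit_quot_small z t : (0 < t)%N -> `|1 + 2 * z| < 3 -> limit_quot z t != 0.
Proof.
move=> t0 z3; have u0 := limit_node_gt0 t0; have t1 : 1 <= t%:R :> R by rewrite ler1n.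
have u3 := limit_node_ge t0.
rewrite normr_eq0 subr_eq0 eq_sym lt_eqF// ltr_pdivrMr ?exprn_gt0// mul1r.
rewrite -[X in X < _]real_normK ?num_real// ltrXn2r ?nnegrE// ?ltW//.
by apply: lt_le_trans u3; lra.
Qed.

Lemma cvg_quot_prod z L (K : nat -> nat) : infprod_to (limit_quot z) L ->
  (forall m, (K m <= (q (nn m))./2)%N) -> K @ \oo --> \oo ->
  (fun m => quot_prod d (nn m) z (K m)) @ \oo --> L.
Proof.
move=> /infprod_limit_quot HL Kq Koo.
apply: (cvg_prod_dominated _ Koo _ _ HL (M := 16 * (1 + 2 * z) ^+ 2)).
- by rewrite mulr_ge0// sqr_ge0.
- by move=> t t0; exact: cvg_sin_quot.
near=> m; move=> t /andP[t0 tK]; apply: sin_quot_le => //.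
  by near: m; exact: near_delta_small.
by rewrite t0 (leq_trans tK).
Unshelve. all: by end_near. Qed.

Lemma cvg_shifted_sudler z (C L0 L : R) :
  (fun m => sudler (q (nn m)) x) @ \oo --> C ->
  infprod_to (limit_quot 0) L0 -> infprod_to (limit_quot z) L ->
  (fun m => shifted_sudler d (q (nn m)) (z * dl (nn m))) @ \oo --> C * (`|1 + z| * L / L0).
Proof.
move=> HC H0 Hz.
have L00 : 0 < L0.
  rewrite lt_def (infprod_limit_quot_ge0 H0) andbT.
  apply: (infprod_limit_quot_neq0 _ H0) => t t0.
  by apply: limit_quot_small => //; rewrite mulr0 addr0 normr1 ltr1n.
have Lz0 := infprod_limit_quot_ge0 Hz.
have C0 : 0 <= C.
  apply: (cvgr_to_ge HC); apply: nearW => m; apply: prodr_ge0 => r _; exact: normr_ge0.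
(* The two halves of the folded product both tend to the same limit. Dividing the last sine by D
   keeps the limit of g positive at y = 0, so g may be a denominator there. *)
pose g y m := quot_prod d (nn m) y (q (nn m))./2 * quot_prod d (nn m) y (q (nn m)).-1./2
   * (sin (arg d (nn m) (2 * (1 + y))) / D m) ^+ 2.
have Hg y Ly : infprod_to (limit_quot y) Ly -> g y @ \oo --> Ly * Ly * (2 * (1 + y)) ^+ 2.
  move=> Hy; apply: cvgM.
    apply: cvgM; apply: cvg_quot_prod => //; first exact: cvg_half_cfq.
      by move=> m; rewrite half_leq// leq_pred.
    exact: cvg_half_pred_cfq.
  rewrite expr2; under eq_fun do rewrite expr2.
  by apply: cvgM; apply: cvg_scaled_sin; exact: cvg_cst.
have E m : pi * (1 + `|dl (nn m)|) <= 4 -> shifted_sudler d (q (nn m)) (z * dl (nn m)) ^+ 2 * g 0 m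
    = sudler (q (nn m)) x ^+ 2 * g z m.
  move=> ds; have := shifted_sudler_quot d_gt0 (nn_gt0 m) ds z.
  rewrite /g addr0 mulr1 !expr_div_n.
  by rewrite !mulrA => ->.
have T0 m : 0 <= shifted_sudler d (q (nn m)) (z * dl (nn m)).
  by apply: prodr_ge0 => r _; exact: normr_ge0.
(* All products are nonnegative, so the limit is recovered from its square. *)
have V : (fun m => Num.sqrt (sudler (q (nn m)) x * sudler (q (nn m)) x * (g z m / g 0 m)))
  @ \oo --> C * (`|1 + z| * L / L0).
  have -> : C * (`|1 + z| * L / L0)
     = Num.sqrt (C * C * (L * L * (2 * (1 + z)) ^+ 2 / (L0 * L0 * (2 * (1 + 0)) ^+ 2))).
    have -> : C * C * (L * L * (2 * (1 + z)) ^+ 2 / (L0 * L0 * (2 * (1 + 0)) ^+ 2))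
      = (C * ((1 + z) * L / L0)) ^+ 2 by field; rewrite gt_eqF.
    by rewrite sqrtr_sqr !normrM normfV (ger0_norm C0) (ger0_norm Lz0) (gtr0_norm L00).
  apply: continuous_cvg; first exact: sqrt_continuous.
  apply: cvgM; first by apply: cvgM.
  apply: cvgM; first exact: Hg.
  apply: cvgV; last exact: Hg.
  by rewrite addr0 mulr1 !mulf_neq0 ?gt_eqF// ?expf_neq0.
apply: cvg_trans V; apply: near_eq_cvg; near=> m.
have g0 : g 0 m != 0.
  have : 0 < g 0 m.
    near: m; apply: (cvgr_gt _ (Hg _ _ H0)).
    by rewrite addr0 mulr1 !mulr_gt0// exprn_gt0.
  by move/gt_eqF/negbT.
rewrite -expr2 mulrA -E; last by near: m; exact: near_delta_small.
by rewrite mulfK// sqrtr_sqr ger0_norm.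
Unshelve. all: by end_near. Qed.

End SudlerLimit.

(** * Limit identities *)

Section RealPowers.
Variable R : realType.
Implicit Types (x e : R) (f : nat -> R).

Lemma powR_prod f e m n : (forall t, 0 <= f t) ->
  \prod_(m <= t < n) f t `^ e = (\prod_(m <= t < n) f t) `^ e.
Proof.
move=> f0; elim: n => [|n IH]; first by rewrite !big_geq// powR1.
have [mn|nm] := leqP m n; last by rewrite !big_geq// powR1.
by rewrite !big_nat_recr//= IH powRM// prodr_ge0.
Qed.

(** L > 0 makes the power continuous at L even for negative exponents; this is why the limit
    products are shown not to vanish. *)
Lemma infprod_powR f e (L : R) : (forall t, 0 <= f t) -> 0 < L ->
  infprod_to f L -> infprod_to (fun t => f t `^ e) (L `^ e).
Proof.
move=> f0 L0 fL; rewrite /infprod_to; under eq_fun do rewrite powR_prod//.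
suff cts : {for L, continuous (fun x => x `^ e)} by exact: (continuous_cvg _ cts fL).
apply: differentiable_continuous; apply/derivable1_diffP.
by apply: derivable_powR; rewrite in_itv/= L0.
Qed.

Lemma infprodM f g (L M : R) : infprod_to f L -> infprod_to g M ->
  infprod_to (fun t => f t * g t) (L * M).
Proof.
by move=> fL gM; rewrite /infprod_to; under eq_fun do rewrite big_split/=; exact: cvgM.
Qed.

Lemma infprod_prod (f : nat -> nat -> R) (L : nat -> R) m n :
  (forall s, (m <= s < n)%N -> infprod_to (f s) (L s)) ->
  infprod_to (fun t => \prod_(m <= s < n) f s t) (\prod_(m <= s < n) L s).
Proof.
elim: n => [|n IH] H.
  rewrite big_geq// /infprod_to; under eq_fun do (under eq_bigr do rewrite big_geq//; rewrite big1_eq).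
  exact: cvg_cst.
have [mn|nm] := leqP m n; last first.
  rewrite big_geq// /infprod_to; under eq_fun do (under eq_bigr do rewrite big_geq//; rewrite big1_eq).
  exact: cvg_cst.
rewrite big_nat_recr//=.
have -> : (fun t => \prod_(m <= s < n.+1) f s t) = (fun t => (\prod_(m <= s < n) f s t) * f n t).
  by apply/funext => t; rewrite big_nat_recr.
apply: infprodM; last by apply: H; rewrite mn leqnn.
by apply: IH => s /andP[ms sn]; apply: H; rewrite ms ltnW.
Qed.

Lemma eq_infprod f g (L : R) : (forall t, (0 < t)%N -> f t = g t) ->
  infprod_to f L -> infprod_to g L.
Proof.
move=> fg; rewrite /infprod_to => H.
have -> // : (fun T => \prod_(1 <= t < T.+1) g t) = (fun T => \prod_(1 <= t < T.+1) f t).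
by apply/funext => T; apply: eq_big_nat => t /andP[t0 _]; rewrite fg.
Qed.

Lemma root_powR x n : 0 <= x -> (0 < n)%N -> (x `^ (1 / n%:R)) ^+ n = x.
Proof.
move=> x0 n0; rewrite -powR_mulrn ?powR_ge0// -powRrM divfK ?pnatr_eq0 -?lt0n//.
by rewrite powRr1.
Qed.

Lemma rootV_powR x n : 0 <= x -> (0 < n)%N -> (x `^ (- (1 / n%:R))) ^+ n = x^-1.
Proof. by move=> x0 n0; rewrite powRN exprVn root_powR. Qed.

End RealPowers.

(** * The limit of q_n |delta_n| and the size of the nodes *)

Section LimitOfQDelta.
Variables (R : realType) (l : nat) (a : nat -> nat) (k : nat).
Hypothesis l_gt0 : (0 < l)%N.
Hypothesis a_gt0 : forall i : nat, (1 <= i <= l)%N -> (0 < a i)%N.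
Hypothesis kl : (1 <= k <= l)%N.
Local Notation dp := (pure_digits l a).
Local Notation lam := (`|coef_e R l a k * coef_c R l a k|).
Local Notation rho := (alpha_sigma R l a k).
Local Notation ratio := (`|delta R dp k.-1| / `|delta R dp k|).

Lemma delta_ratio_ge1 : 1 <= ratio.
Proof.
have dp_pos := pure_digits_pos l_gt0 a_gt0.
rewrite ler_pdivlMr ?delta_gt0// mul1r.
have k0 : (0 < k)%N by case/andP: kl.
rewrite (delta_recE R k.-1 dp_pos) prednK// ler_wpDr//.
by rewrite ler_peMl// ler1n dp_pos.
Qed.

(** The empty preperiod, which makes the results for general h available at h = 0. *)
Let no_digit (i : nat) : (1 <= i <= 0)%N -> (0 < 0)%N.
Proof. by case: i. Qed.

Lemma alpha_sigma_ge0 : 0 <= rho.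
Proof.
have V := cvg_reversal (R := R) l_gt0 no_digit a_gt0 kl.
by apply: (cvgr_to_ge V); apply: nearW => m; rewrite divr_ge0.
Qed.

Lemma inv_lambda_gt0 : 0 < rho + ratio.
Proof. by apply: ltr_wpDl; [exact: alpha_sigma_ge0|exact: lt_le_trans delta_ratio_ge1]. Qed.

Lemma cvg_qdelta_ratio (h : nat) (b : nat -> nat) :
  (forall i : nat, (1 <= i <= h)%N -> (0 < b i)%N) ->
  (fun m => (cfq (cf_digits h l b a) (h + m * l + k))%:R
    * `|delta R (cf_digits h l b a) (h + m * l + k)|) @ \oo --> (rho + ratio)^-1.
Proof.
move=> b_gt0; have H := cvg_inv_qdelta (R := R) l_gt0 b_gt0 a_gt0 kl.
have S0 : rho + ratio != 0 by rewrite gt_eqF// inv_lambda_gt0.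
apply: cvg_trans (cvgV S0 H); apply: near_eq_cvg; apply: nearW => m.
by rewrite /= invrK.
Qed.

(* The limit depends only on the period, and it is explicit when h = 0. *)
Lemma lambdaE : lam = (rho + ratio)^-1.
Proof.
have H1 := cvg_qdelta_ratio no_digit.
have /andP[_ kl'] := kl; have H2 := cvg_pure_qdelta (R := R) l_gt0 a_gt0 kl'.
exact: (cvg_unique _ H2 H1).
Qed.

Lemma lambda_gt0 : 0 < lam.
Proof. by rewrite lambdaE invr_gt0; exact: inv_lambda_gt0. Qed.

Lemma alpha_sigma_irrational (t : nat) (z : int) : (0 < t)%N -> t%:R * rho != z%:~R.
Proof.
by case: t => // t _; rewrite pmulrn; apply: cf_value_irrational => //; exact: rev_block_pos.
Qed.

(** As 1 / lam = rho + ratio, the fractional part combines with t rho into a floor: the node is 2 (t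
    ratio + floor(t rho)) + 1, and ratio >= 1. *)
Lemma limit_node_lb t : (0 < t)%N -> 2 * t%:R + 1 <= limit_node lam rho t.
Proof.
move=> t0; rewrite /limit_node lambdaE invrK.
have t1 : 0 <= t%:R :> R by [].
have F0 : 0 <= (Num.floor (t%:R * rho))%:~R :> R.
  by rewrite ler0z floor_ge0 mulr_ge0// alpha_sigma_ge0.
have : 0 <= t%:R * (ratio - 1) by rewrite mulr_ge0// subr_ge0 delta_ratio_ge1.
move: ratio F0 => r; rewrite /fract; move: (Num.floor _)%:~R => f F0 H.
have -> : t%:R * (rho + r) - (t%:R * rho - f) = t%:R * r + f by ring.
lra.
Qed.

End LimitOfQDelta.

(** * Identities satisfied by the limit C *)

Section LimitIdentities.
Variables (R : realType) (h l : nat) (b a : nat -> nat) (C : R) (k : nat).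
Hypothesis l_gt0 : (0 < l)%N.
Hypothesis b_gt0 : forall i : nat, (1 <= i <= h)%N -> (0 < b i)%N.
Hypothesis a_gt0 : forall i : nat, (1 <= i <= l)%N -> (0 < a i)%N.
Hypothesis kl : (1 <= k <= l)%N.

Local Notation dig := (cf_digits h l b a).
Local Notation c := (const_c l a).
Local Notation A := (const_a R l a).
Local Notation B := (const_b R l a).
Local Notation nn m := (h + m * l + k)%N.
Local Notation lam := (`|coef_e R l a k * coef_c R l a k|).
Local Notation rho := (alpha_sigma R l a k).
Local Notation dl m := (delta R dig (nn m)).
Local Notation Q m := (cfq dig (nn m)).

Hypothesis C_lim : (fun m => sudler (Q m) (cf_value R dig)) @ \oo --> C.
Hypothesis C_gt0 : 0 < C.

Let dig_pos : pos_digits dig := cf_digits_pos l_gt0 b_gt0 a_gt0.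
Let nn_ge m : (m <= nn m)%N.
Proof. by rewrite -addnA addnCA (leq_trans _ (leq_addr _ _))// leq_pmulr. Qed.
Let nn_gt0 m : (0 < nn m)%N.
Proof. by rewrite addn_gt0; case/andP: kl => ->; rewrite orbT. Qed.

Local Notation quot z := (limit_quot lam rho z).

Lemma period_quot_cvg z : exists L : R, infprod_to (quot z) L.
Proof.
apply: (infprod_limit_quot_cvg dig_pos nn_ge nn_gt0).
- by rewrite (lambdaE R l_gt0 a_gt0 kl); exact: cvg_qdelta_ratio.
- exact: lambda_gt0.
- exact: cvg_reversal.
- exact: alpha_sigma_irrational.
- exact: limit_node_lb.
Qed.

Lemma period_quot_small z (L : R) : `|1 + 2 * z| < 3 -> infprod_to (quot z) L -> 0 < L.
Proof.
move=> z3 HL; rewrite lt_def (infprod_limit_quot_ge0 HL) andbT.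
have NL := limit_node_lb R l_gt0 a_gt0 kl.
apply: (infprod_limit_quot_neq0 dig_pos nn_ge nn_gt0 _ _ _ _ NL _ HL).
- by rewrite (lambdaE R l_gt0 a_gt0 kl); exact: cvg_qdelta_ratio.
- exact: lambda_gt0.
- exact: cvg_reversal.
- exact: alpha_sigma_irrational.
- by move=> t t0; exact: limit_quot_small.
Qed.

Variable L : R -> R.
Hypothesis L_lim : forall z, infprod_to (quot z) (L z).

Definition kappa (z : R) : R := `|1 + z| * L z / L 0.

Lemma L_ge0 z : 0 <= L z.
Proof. exact: (infprod_limit_quot_ge0 (@L_lim z)). Qed.

Lemma L0_gt0 : 0 < L 0.
Proof. by apply: period_quot_small (@L_lim 0); rewrite mulr0 addr0 normr1 ltr1n. Qed.

Lemma cvg_shifted_kappa z :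
  (fun m => shifted_sudler dig (Q m) (z * dl m)) @ \oo --> C * kappa z.
Proof.
apply: (cvg_shifted_sudler dig_pos nn_ge nn_gt0 _ _ _ _ _ C_lim (@L_lim 0) (@L_lim z)).
- by rewrite (lambdaE R l_gt0 a_gt0 kl); exact: cvg_qdelta_ratio.
- exact: lambda_gt0.
- exact: cvg_reversal.
- exact: alpha_sigma_irrational.
- exact: limit_node_lb.
Qed.

Lemma cvg_shifted_kappaS z :
  (fun m => shifted_sudler dig (Q m.+1) (z * dl m.+1)) @ \oo --> C * kappa z.
Proof.
exact: (@cvg_subseq R (fun m => shifted_sudler dig (Q m) (z * dl m)) _ S _ (@cvg_shifted_kappa z)).
Qed.

Lemma cvg_shifted_kappaSS z :
  (fun m => shifted_sudler dig (Q m.+2) (z * dl m.+2)) @ \oo --> C * kappa z.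
Proof.
exact: (@cvg_subseq R (fun m => shifted_sudler dig (Q m.+1) (z * dl m.+1)) _ S _
  (@cvg_shifted_kappaS z)).
Qed.

Lemma kappa0 : kappa 0 = 1.
Proof. by rewrite /kappa addr0 normr1 mul1r mulfV// gt_eqF// L0_gt0. Qed.

Lemma delta_step m : dl m.+1 = B * dl m.
Proof.
have := delta_period R l_gt0 b_gt0 a_gt0 (m * l + k); rewrite addnA => <-.
by congr delta; rewrite mulSn; lia.
Qed.

Lemma cfq_step m : (Q m.+2)%:R = c%:R * (Q m.+1)%:R - (-1) ^+ l * (Q m)%:R :> R.
Proof.
have S := cf_solution_tail (R := R) (h := h) (b := b) (@cf_solution_cfq R dig).
have E0 : (h + (m * l + k) = nn m)%N by lia.
have E1 : (h + (m * l + k + l) = nn m.+1)%N by rewrite mulSn; lia.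
have E2 : (h + (m * l + k + l + l) = nn m.+2)%N by rewrite !mulSn; lia.
by have := cf_solution_trace (m * l + k) S; rewrite E0 E1 E2.
Qed.

Lemma cvg_prod_kappa (z : nat -> R) :
  (fun m => \prod_(0 <= s < c) shifted_sudler dig (Q m.+1) (z s * dl m.+1)) @ \oo
  --> \prod_(0 <= s < c) (C * kappa (z s)).
Proof. by apply: cvg_prod_nat => s _; exact: cvg_shifted_kappaS. Qed.

Section Even.
Hypothesis l_even : ~~ odd l.

Lemma const_abM_even : A * B = 1.
Proof. by rewrite const_abM// -signr_odd (negbTE l_even). Qed.

Lemma cfq_step_even m : (Q m + Q m.+2 = c * Q m.+1)%N.
Proof.
apply/eqP; rewrite -(eqr_nat R) natrD natrM cfq_step -signr_odd (negbTE l_even) mul1r.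
by rewrite addrC subrK.
Qed.

(* The block of length q_n comes first. *)
Lemma prod_kappa_tail : \prod_(0 <= s < c) (C * kappa s%:R) = C * (C * kappa (A ^+ 2)).
Proof.
have V := @cvg_prod_kappa (fun s => s%:R).
have W : (fun m => shifted_sudler dig (Q m) (0 * dl m)
    * shifted_sudler dig (Q m.+2) (A ^+ 2 * dl m.+2)) @ \oo --> C * kappa 0 * (C * kappa (A ^+ 2)).
  by apply: cvgM; [exact: cvg_shifted_kappa|exact: cvg_shifted_kappaSS].
rewrite kappa0 mulr1 in W; apply: (cvg_unique _ V _) => //.
apply: cvg_trans W; apply: near_eq_cvg; apply: nearW => m.
have := @shifted_sudlerM R dig (nn m.+1) c 0; rewrite -cfq_step_even shifted_sudlerD.
rewrite mul0r add0r (_ : delta R dig (nn m) = A ^+ 2 * dl m.+2) => [->|].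
  by apply: eq_bigr => s _; rewrite add0r.
rewrite !delta_step; transitivity ((A * B) * (A * B) * dl m); last by ring.
by rewrite const_abM_even !mul1r.
Qed.

(* The block of length q_(n+2l) comes first. *)
Lemma prod_kappa_head : \prod_(0 <= s < c) (C * kappa s%:R) = C * (C * kappa (B ^+ 2)).
Proof.
have V := @cvg_prod_kappa (fun s => s%:R).
have W : (fun m => shifted_sudler dig (Q m.+2) (0 * dl m.+2)
    * shifted_sudler dig (Q m) (B ^+ 2 * dl m)) @ \oo --> C * kappa 0 * (C * kappa (B ^+ 2)).
  by apply: cvgM; [exact: cvg_shifted_kappaSS|exact: cvg_shifted_kappa].
rewrite kappa0 mulr1 in W; apply: (cvg_unique _ V _) => //.
apply: cvg_trans W; apply: near_eq_cvg; apply: nearW => m.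
have := @shifted_sudlerM R dig (nn m.+1) c 0; rewrite -cfq_step_even addnC shifted_sudlerD.
rewrite mul0r add0r (_ : delta R dig (nn m.+2) = B ^+ 2 * dl m) => [->|].
  by apply: eq_bigr => s _; rewrite add0r.
by rewrite !delta_step; ring.
Qed.

(* The shift B^2 lies in (0, 1), where no factor of the limit product vanishes. *)
Lemma prod_kappa_gt0 : 0 < \prod_(0 <= s < c) (C * kappa s%:R).
Proof.
have B2 : 0 <= B ^+ 2 by exact: sqr_ge0.
have B1 : B ^+ 2 < 1.
  rewrite -[B ^+ 2]real_normK ?num_real// exprn_ilt1// ?normr_lt1//.
  exact: const_b_lt1.
have LB : 0 < L (B ^+ 2).
  by apply: period_quot_small (@L_lim _); rewrite ger0_norm; lra.
have K : 0 < kappa (B ^+ 2).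
  by rewrite /kappa divr_gt0 ?L0_gt0// mulr_gt0// normr_gt0 gt_eqF// ltr_wpDr.
by rewrite prod_kappa_head; apply: mulr_gt0 => //; exact: mulr_gt0.
Qed.

(** For s >= 1 the lower bound 3 for the nodes does not exclude a zero factor; positivity is read
    off from the whole product. *)
Lemma L_nat_gt0 s : (s < c)%N -> 0 < L s%:R.
Proof.
move=> sc; rewrite lt_def L_ge0 andbT; apply/negP => /eqP Ls.
have := prod_kappa_gt0; rewrite (bigD1_seq s) ?mem_index_iota ?iota_uniq//=.
by rewrite /kappa Ls mulr0 mul0r mulr0 mul0r ltxx.
Qed.

Lemma L_sqr_gt0 : 0 < L (A ^+ 2).
Proof.
rewrite lt_def L_ge0 andbT; apply/negP => /eqP Ls.
have := prod_kappa_gt0; rewrite prod_kappa_tail /kappa Ls.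
by rewrite mulr0 mul0r !mulr0 ltxx.
Qed.

(** The terms |1 + s| multiply to c!, and kappa 0 = 1. One of the c - 1 factors 1 / L 0 cancels
    against that of kappa (A^2), and C^2 cancels against C^c. *)
Lemma limit_even_expr : C ^+ (c - 2) = (1 + A ^+ 2) / (c`!)%:R
  * (L 0 ^+ (c - 2) * L (A ^+ 2) / \prod_(1 <= s < c) L s%:R).
Proof.
have c3 := const_c_ge3 l_gt0 a_gt0 l_even.
have L0 := L0_gt0; have C0 : C != 0 by rewrite gt_eqF.
have P0 : \prod_(1 <= s < c) L s%:R != 0.
  rewrite prodf_seq_neq0; apply/allP => s; rewrite mem_index_iota => /andP[_ sc].
  by rewrite gt_eqF// L_nat_gt0.
have fE n : \prod_(1 <= s < n.+1) `|1 + s%:R| = (n.+1`!)%:R :> R.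
  elim: n => [|n IH]; first by rewrite big_geq.
  by rewrite big_nat_recr//= IH (factS n.+1) natrM mulrC nat1r ger0_norm.
have [n cE] : exists n, c = n.+2 by exists (c - 2)%N; lia.
have KE : \prod_(1 <= s < n.+2) kappa s%:R
    = (n.+2`!)%:R * \prod_(1 <= s < n.+2) L s%:R / L 0 ^+ n.+1.
  by rewrite /kappa big_split big_split/= fE prodr_const_nat exprVn subn1.
have := prod_kappa_tail; rewrite big_split/= prodr_const_nat subn0.
rewrite cE in P0 *; rewrite big_ltn// KE kappa0 mul1r /kappa subn2/=.
have F0 : (n.+2`!)%:R != 0 :> R by rewrite pnatr_eq0 gtn_eqF// fact_gt0.
have A2 : `|1 + A ^+ 2| = 1 + A ^+ 2 by rewrite ger0_norm// addr_ge0// sqr_ge0.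
rewrite A2; move: (\prod_(_ <= _ < _) _) P0 (_%:R) F0 (L 0) L0 (L (A ^+ 2)) (1 + A ^+ 2).
move=> P P0 F F0 z z0 y w H.
have z1 : z != 0 by rewrite gt_eqF.
have zn : z ^+ n != 0 by rewrite expf_neq0.
have K0 : C * C * (F * P / z ^+ n.+1) != 0.
  by rewrite !mulf_neq0// invr_neq0// expf_neq0.
apply: (mulfI K0); transitivity (C ^+ n.+2 * (F * P / z ^+ n.+1)).
  by rewrite !exprS; ring.
by rewrite H exprS; move: (z ^+ n) zn => v v0; field; rewrite F0 z1 P0 v0.
Qed.

End Even.

Section Odd.
Hypothesis l_odd : odd l.

Lemma const_abM_odd : A * B = -1.
Proof. by rewrite const_abM// -signr_odd l_odd. Qed.

Lemma cfq_step_odd m : (Q m + c * Q m.+1 = Q m.+2)%N.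
Proof.
apply/eqP; rewrite -(eqr_nat R) natrD natrM cfq_step -signr_odd l_odd mulN1r opprK.
by rewrite addrC.
Qed.

(** The block of length q_n comes first, so the c blocks after it start from delta_n = - A
    delta_(n+l). The products at q_n and at q_(n+2l) have the same limit C, which cancels. *)
Lemma prod_kappa_odd : \prod_(0 <= s < c) (C * kappa (s%:R - A)) = 1.
Proof.
have V : (fun m => shifted_sudler dig (Q m) (0 * dl m)
    * \prod_(0 <= s < c) shifted_sudler dig (Q m.+1) ((s%:R - A) * dl m.+1)) @ \oo
    --> C * kappa 0 * \prod_(0 <= s < c) (C * kappa (s%:R - A)).
  by apply: cvgM; [exact: cvg_shifted_kappa|exact: (@cvg_prod_kappa (fun s => s%:R - A))].
have W := @cvg_shifted_kappaSS 0; rewrite kappa0 mulr1 in V W.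
suff E : C * \prod_(0 <= s < c) (C * kappa (s%:R - A)) = C.
  by apply: (mulfI (lt0r_neq0 C_gt0)); rewrite mulr1.
apply: (cvg_unique _ V _) => //.
apply: cvg_trans W; apply: near_eq_cvg; apply: nearW => m.
rewrite !mul0r -cfq_step_odd shifted_sudlerD add0r shifted_sudlerM; congr (_ * _).
apply: eq_bigr => s _; congr shifted_sudler; rewrite delta_step.
transitivity (s%:R * (B * dl m) - (A * B) * dl m); last by ring.
by rewrite const_abM_odd; ring.
Qed.

Lemma L_subr_gt0 s : (s < c)%N -> 0 < L (s%:R - A).
Proof.
move=> sc; rewrite lt_def L_ge0 andbT; apply/negP => /eqP Ls.
have := oner_neq0 R; rewrite -prod_kappa_odd (bigD1_seq s) ?mem_index_iota ?iota_uniq//=.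
by rewrite /kappa Ls mulr0 mul0r mulr0 mul0r eqxx.
Qed.

Lemma limit_odd_expr : C ^+ c = (\prod_(0 <= s < c) `|1 + (s%:R - A)|)^-1
  * (L 0 ^+ c / \prod_(0 <= s < c) L (s%:R - A)).
Proof.
have L0 : L 0 ^+ c != 0 by rewrite expf_neq0// gt_eqF// L0_gt0.
have := prod_kappa_odd; rewrite big_split/= prodr_const_nat subn0 /kappa.
rewrite big_split/= big_split/= prodr_const_nat subn0 exprVn.
move: (C ^+ c) (\prod_(_ <= _ < _) _) (\prod_(_ <= _ < _) _) (L 0 ^+ c) L0 => x y P z z0 H.
have : P * y != 0.
  by apply/negP => /eqP yP; move: H; rewrite yP mul0r mulr0 => /eqP; rewrite eq_sym oner_eq0.
rewrite mulf_eq0 negb_or => /andP[P0 y0].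
have -> : x = x * (P * y / z) * (z / (P * y)) by field; rewrite z0 y0 P0.
by rewrite H; field; rewrite y0 P0.
Qed.

End Odd.
End LimitIdentities.

(** The nodes exceed 1, which is why the first factor of the result carries no absolute value. *)
Lemma limit_quot0E (R : realType) (lam rho : R) t :
  (forall t, (0 < t)%N -> 2 * t%:R + 1 <= limit_node lam rho t) -> (0 < t)%N ->
  limit_quot lam rho 0 t = 1 - 1 / limit_node lam rho t ^+ 2.
Proof.
move=> NL t0; rewrite /limit_quot mulr0 addr0 expr1n ger0_norm// subr_ge0.
have t1 : 1 <= t%:R :> R by rewrite ler1n.
have u1 : 1 <= limit_node lam rho t by apply: le_trans (NL _ t0); lra.
by rewrite ler_pdivrMr ?exprn_gt0 ?(lt_le_trans ltr01)// mul1r exprn_ege1.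
Qed.

Theorem corollary1 (R : realType) (h l : nat) (b a : nat -> nat) (C : nat -> R)
  (l_gt0 : (0 < l)%N)
  (b_gt0 : forall i : nat, (1 <= i <= h)%N -> (0 < b i)%N)
  (a_gt0 : forall i : nat, (1 <= i <= l)%N -> (0 < a i)%N)
  (C_lim : forall k : nat, (1 <= k <= l)%N ->
     (fun m : nat => sudler (cfq (cf_digits h l b a) (h + m * l + k)%N)
                            (cf_value R (cf_digits h l b a))) @ \oo --> C k)
  (C_gt0 : forall k : nat, (1 <= k <= l)%N -> 0 < C k) :
  let c : nat := const_c l a in
  let A : R := const_a R l a in
  let u : nat -> nat -> R := seq_u R l a in
  forall k : nat, (1 <= k <= l)%N ->
    (~~ odd l ->
       exists2 L : R,
         infprod_to (fun t : nat =>
           (1 - 1 / u k t ^+ 2)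
           * `|1 - (1 + 2 * A ^+ 2) ^+ 2 / u k t ^+ 2| `^ (1 / (c%:R - 2))
           * \prod_(1 <= s < c)
               `|1 - (1 + 2 * s%:R) ^+ 2 / u k t ^+ 2| `^ (- (1 / (c%:R - 2)))) L
         & C k = ((1 + A ^+ 2) / (c`!)%:R) `^ (1 / (c%:R - 2)) * L)
    /\
    (odd l ->
       exists2 L : R,
         infprod_to (fun t : nat =>
           (1 - 1 / u k t ^+ 2)
           * \prod_(0 <= s < c)
               `|1 - (1 + 2 * s%:R - 2 * A) ^+ 2 / u k t ^+ 2| `^ (- (1 / c%:R))) L
         & C k = 1 / (\prod_(1 <= s < c.+1) `|s%:R - A| `^ (1 / c%:R)) * L).
Proof.
move=> c A u k kl; have Ck := C_lim k kl; have Ck0 := C_gt0 k kl.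
(* All limit products at once, as a function of the real shift z. *)
have [L HL] := choice (period_quot_cvg (R := R) l_gt0 b_gt0 a_gt0 kl).
have NL := limit_node_lb R l_gt0 a_gt0 kl.
have L0 := L0_gt0 l_gt0 b_gt0 a_gt0 kl HL.
have Lge z : 0 <= L z by exact: infprod_limit_quot_ge0 (HL z).
split=> lo.
  have c3 : (3 <= c)%N := const_c_ge3 l_gt0 a_gt0 lo.
  have c0 : (0 < c - 2)%N by lia.
  have -> : c%:R - 2 = (c - 2)%:R :> R by rewrite natrB//; lia.
  have LA : 0 < L (A ^+ 2) := L_sqr_gt0 l_gt0 b_gt0 a_gt0 kl Ck Ck0 HL lo.
  have Ls s : (s < c)%N -> 0 < L s%:R by exact: (L_nat_gt0 l_gt0 b_gt0 a_gt0 kl Ck Ck0 HL lo).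
  exists (L 0 * L (A ^+ 2) `^ (1 / (c - 2)%:R)
    * \prod_(1 <= s < c) L s%:R `^ (- (1 / (c - 2)%:R))).
    (* [u k t] unfolds to the limit node, and 1 + 2 z becomes 1 + 2 A^2 and 1 + 2 s. *)
    apply: eq_infprod (infprodM (infprodM (HL 0) _) (infprod_prod _)).
    - by move=> t t0; rewrite limit_quot0E.
    - by apply: infprod_powR => //; exact: HL.
    - move=> s /andP[_ sc]; by apply: infprod_powR; [|exact: Ls|exact: HL].
  have X0 : 0 <= (1 + A ^+ 2) / (c`!)%:R by rewrite divr_ge0// addr_ge0// sqr_ge0.
  (* Both sides are nonnegative, so their powers of exponent c - 2 may be compared. *)
  apply: (pexpIrn c0); rewrite ?nnegrE ?(ltW Ck0)//.
    by rewrite !mulr_ge0 ?powR_ge0// prodr_ge0// => s _; exact: powR_ge0.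
  rewrite (limit_even_expr l_gt0 b_gt0 a_gt0 kl Ck Ck0 HL lo) !exprMn !root_powR//.
  congr (_ * (_ * _)); rewrite -prodrXl -prodfV; apply: eq_big_nat => s _.
  by rewrite rootV_powR.
have c0 : (0 < c)%N := const_c_gt0 l_gt0 a_gt0.
have Ls s : (s < c)%N -> 0 < L (s%:R - A).
  by exact: (L_subr_gt0 l_gt0 b_gt0 a_gt0 kl Ck Ck0 HL lo).
exists (L 0 * \prod_(0 <= s < c) L (s%:R - A) `^ (- (1 / c%:R))).
  apply: eq_infprod (infprodM (HL 0) (infprod_prod _)).
  - by move=> t t0; rewrite limit_quot0E.
  - move=> s /andP[_ sc]; rewrite /= (_ : 1 + 2 * s%:R - 2 * A = 1 + 2 * (s%:R - A)); last first.
      by rewrite mulrBr addrA.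
    by apply: infprod_powR; [|exact: Ls|exact: HL].
apply: (pexpIrn c0); rewrite ?nnegrE ?(ltW Ck0)//.
  rewrite !mulr_ge0 ?invr_ge0 ?prodr_ge0// => s _; exact: powR_ge0.
rewrite (limit_odd_expr l_gt0 b_gt0 a_gt0 kl Ck Ck0 HL lo) !exprMn expr1n mul1r exprVn.
congr (_^-1 * (_ * _)).
  (* The product over 1, ..., c is reindexed from 0: |(s + 1) - A| is the factor |1 + z| at z = s -
     A. *)
  rewrite big_add1 /= -prodrXl; apply: eq_big_nat => s _.
  by rewrite root_powR// -natr1 addrAC addrC.
by rewrite -prodrXl -prodfV; apply: eq_big_nat => s _; rewrite rootV_powR.
Qed.
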